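(* Let $n\ge1$ be an integer. Consider the following procedure (in two versions: ''canonical'' throughout, or ''terminal'' throughout). Initialization. (1) Let $\mathcal{Q}_0$ be the (finite) set of all canonical (terminal) weight vectors of length $n+1$. (2) For each $w\in\mathcal{Q}_0$, let $M(w)$ be the set of all pairs $(\eta,\mu)$, where $\mu\ge2$ and $\eta$ is a row-minimal canonical (terminal) $\mu$-torsion vector for $w$. Recursion, for $i=1,2,\dots$. (1) Let $\mathcal{Q}_i$ be the set of all minimal matrices of the form $Q_\eta$, where $Q\in\mathcal{Q}_{i-1}$ and $(\eta,\mu)\in M(Q)$. (2) For each $Q_\eta\in\mathcal{Q}_i$ (arising from $Q\in\mathcal{Q}_{i-1}$ and $(\eta,\mu)\in M(Q)$), let $M(Q_\eta)$ be the set of all pairs $(\eta',\mu')\in M(Q)$ such that $\mu'\mid\mu$, the product of all orders of the torsion rows of $(Q_\eta)_{\eta'}$ is at most $(w_0+\dots+w_n)^{n-1}/(w_1\cdots w_n)$, where $(w_0,\dots,w_n)$ is the weight vector, and the matrix $(Q_\eta)_{\eta'}$ is almost free, canonical (terminal) and row-minimal. (3) Terminate if $M(Q_\eta)$ is empty for all $Q_\eta\in\mathcal{Q}_i$ or if $i=n-1$. Then the procedure terminates and its output $\bigcup_i\mathcal{Q}_i$ is precisely the set of all minimal canonical (terminal) degree matrices of $n$-dimensional fake weighted projective spaces.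
   Context: A fake weighted projective space (fwps) is a $\mathbb{Q}$-factorial projective toric variety over $\mathbb{C}$ of Picard number one. Its fan in $\mathbb{Z}^n$ has $n+1$ primitive ray generators $v_0,\dots,v_n$. With $P=[v_0,\dots,v_n]$, the group $K=\mathbb{Z}^{n+1}/\mathrm{im}(P^T)$ is identified with $\mathbb{Z}\times\Gamma$, $\Gamma=\mathbb{Z}/\mu_1\mathbb{Z}\times\dots\times\mathbb{Z}/\mu_s\mathbb{Z}$, $\mu_s\ge2$, $\mu_s\mid\mu_{s-1},\dots,\mu_2\mid\mu_1$ ($s\ge 0$). A degree matrix $Q=[\omega_0,\dots,\omega_n]$ of the fwps has as columns the classes $\omega_i=(w_i,\eta_i)\in\mathbb{Z}\times\Gamma$ of $e_i$, where the identification and numbering are such that $0<w_0\le\dots\le w_n$. Its first row $w=(w_0,\dots,w_n)\in\mathbb{Z}_{>0}^{n+1}$ is the weight vector; the lower $s$ rows are the torsion rows, the $l$-th one having entries in $\mathbb{Z}/\mu_l\mathbb{Z}$ and order $\mu_l$. A matrix with columns in $\mathbb{Z}\times\Gamma$ is almost free if any $n$ of its $n+1$ columns generate $\mathbb{Z}\times\Gamma$; degree matrices are almost free. A canonical (terminal) degree matrix is the degree matrix of an fwps with at most canonical (terminal) singularities. A canonical (terminal) weight vector is a one-row canonical (terminal) degree matrix ($s=0$). For a weight vector $w$, a $\mu$-torsion vector for $w$ is an $\eta\in(\mathbb{Z}/\mu\mathbb{Z})^{n+1}$ such that the matrix with rows $w,\eta$ is a degree matrix (columns in $\mathbb{Z}\times\mathbb{Z}/\mu\mathbb{Z}$);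 $\eta$ is called canonical (terminal) if this degree matrix is so. Two $\mu$-torsion vectors $\eta,\eta'$ for $w$ are row-equivalent if some automorphism of $\mathbb{Z}\times\mathbb{Z}/\mu\mathbb{Z}$ sends $(w_i,\eta_i)$ to $(w_i,\eta_i')$ for all $i$; $\eta$ is row-minimal if it is lexicographically minimal among all $\mu$-torsion vectors for $w$ row-equivalent to $\eta$. Two degree matrices $Q=[\omega_0,\dots,\omega_n]$, $Q'=[\omega_0',\dots,\omega_n']$ with columns in $\mathbb{Z}\times\Gamma$ are row-equivalent if there is an automorphism $\varphi$ of $\mathbb{Z}\times\Gamma$ with $\omega_i'=\varphi(\omega_i)$ for all $i$; they are equivalent if they are row-equivalent up to column permutations fixing their common weight vector. $Q$ is row-minimal (minimal) if $Q\le Q'$ in the row-wise lexicographical order for all $Q'$ row-equivalent (equivalent) to $Q$. Here elements of $\mathbb{Z}/\mu\mathbb{Z}$ are compared via their representatives in $\{0,\dots,\mu-1\}$. $Q_\eta$ denotes the matrix obtained from $Q$ by adjoining $\eta$ as last row; if $(\eta,\mu)\in M(Q)$, this row has entries in $\mathbb{Z}/\mu\mathbb{Z}$. *)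

(* Defs.v *)
(* MathComp, with the classical sets of MathComp-Analysis. *)
From HB Require Import structures.
From mathcomp Require Import all_boot all_order all_fingroup all_algebra.
From mathcomp Require Import mathcomp_extra boolp classical_sets cardinality.

Set Implicit Arguments.
Unset Strict Implicit.
Unset Printing Implicit Defensive.

Import Order.TTheory GRing.Theory Num.Theory.

Local Open Scope ring_scope.

Variant version := Canonical | Terminal.

(* ---- Fans of fake weighted projective spaces and their singularities ---- *)

Definition primitive n (u : 'cV[int]_n) : Prop :=
  \big[gcdz/0]_(j < n) u j 0 = 1.

(* A complete simplicial fan in Z^n with n+1 rays (i.e. of Picard number one)
   is determined by its primitive ray generators, the columns v_0, ..., v_n of
   P: its cones are those spanned by the proper subfamilies of v_0, ..., v_n,
   and completeness says that the v_i generate Q^n as a convex cone.  In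
   particular its maximal cones are the cones over (v_j)_{j != i}. *)
Definition fwps_fan n (P : 'M[int]_(n, n.+1)) : Prop :=
  (forall i, primitive (col i P)) /\
  (forall x : 'cV[rat]_n, exists a : 'cV[rat]_n.+1,
     (forall i, 0 <= a i 0) /\ map_mx intr P *m a = x).

(* u = \sum_j a_j v_j lies in the i-th maximal cone cone(v_j, j != i). *)
Definition in_max_cone n (P : 'M[int]_(n, n.+1)) (i : 'I_n.+1)
    (a : 'cV[rat]_n.+1) (u : 'cV[int]_n) : Prop :=
  [/\ forall j, 0 <= a j 0, a i 0 = 0 & map_mx intr P *m a = map_mx intr u].

(* The primitive lattice vectors u other than the ray generators are the toric
   exceptional divisors D_u over the variety.  The canonical divisor is minus
   the sum of the torus-invariant prime divisors, so its support function on
   the cone containing u is the linear form taking the value 1 on the ray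
   generators: for u = \sum_j a_j v_j, the discrepancy of D_u is
   \sum_j a_j - 1. *)
Definition singularities_at_most (v : version) n (P : 'M[int]_(n, n.+1)) : Prop :=
  forall (i : 'I_n.+1) (a : 'cV[rat]_n.+1) (u : 'cV[int]_n),
    primitive u -> (forall k, u <> col k P) -> in_max_cone P i a u ->
    let discrepancy := \sum_j a j 0 - 1 in
    match v with
    | Canonical => 0 <= discrepancy
    | Terminal => 0 < discrepancy
    end.

(* ---- Degree matrices ---- *)

(* Gam [:: mu_1; ...; mu_s] is Z/mu_1 x ... x Z/mu_s.  Since 'Z_m is Z/m only
   for m >= 2, the orders are required to be at least 2 in [torsion_orders]. *)
Fixpoint Gam (mu : seq nat) : zmodType :=
  if mu is m :: mu' then ('Z_m * Gam mu')%type else 'I_1.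

Fixpoint Gam_rcons (mu : seq nat) (m : nat) :
    Gam mu -> 'Z_m -> Gam (rcons mu m) :=
  match mu with
  | [::] => fun _ x => (x, 0)
  | _ :: _ => fun g x => (g.1, Gam_rcons g.2 x)
  end.

Fixpoint residues (mu : seq nat) : Gam mu -> seq nat :=
  match mu with
  | [::] => fun=> [::]
  | _ :: _ => fun g => nat_of_ord g.1 :: residues g.2
  end.

Definition torsion_orders (mu : seq nat) : Prop :=
  all (fun m => 2 <= m)%N mu /\ sorted (fun m m' => m' %| m)%N mu.

(* A matrix Q = [omega_0, ..., omega_n] with columns in Z x Gam mu. *)
Definition gmat (n : nat) (mu : seq nat) : Type :=
  {ffun 'I_n.+1 -> int * Gam mu}.

Definition weight n mu (Q : gmat n mu) (i : 'I_n.+1) : int := (Q i).1.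

(* The matrix whose rows are those of Q followed by eta. *)
Definition adjoin n mu (Q : gmat n mu) m (eta : {ffun 'I_n.+1 -> 'Z_m}) :
    gmat n (rcons mu m) :=
  [ffun i => ((Q i).1, Gam_rcons (Q i).2 (eta i))].

(* Columns of Q are the images of the classes of the e_i under an isomorphism
   Z^(n+1) / im(P^T) -> Z x Gam mu; that is, e_i |-> omega_i is a surjective
   homomorphism Z^(n+1) -> Z x Gam mu with kernel im(P^T). *)
Definition degree_matrix_of n (P : 'M[int]_(n, n.+1)) mu (Q : gmat n mu) :
    Prop :=
  [/\ torsion_orders mu,
      forall g : int * Gam mu, exists c : 'I_n.+1 -> int,
        \sum_i Q i *~ c i = g,
      forall c : 'cV[int]_n.+1,
        \sum_i Q i *~ c i 0 = 0 <-> exists x : 'cV[int]_n, c = P^T *m x,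
      forall i, 0 < weight Q i
    & forall i j : 'I_n.+1, (i <= j)%N -> weight Q i <= weight Q j].

Definition degree_matrix n mu (Q : gmat n mu) : Prop :=
  exists P : 'M[int]_(n, n.+1), fwps_fan P /\ degree_matrix_of P Q.

Definition degree_matrix_at_most (v : version) n mu (Q : gmat n mu) : Prop :=
  exists P : 'M[int]_(n, n.+1),
    [/\ fwps_fan P, singularities_at_most v P & degree_matrix_of P Q].

Definition almost_free n mu (Q : gmat n mu) : Prop :=
  forall (k : 'I_n.+1) (g : int * Gam mu), exists c : 'I_n.+1 -> int,
    \sum_(i | i != k) Q i *~ c i = g.

(* ---- Equivalence and minimality ---- *)

Definition row_equiv n mu (Q Q' : gmat n mu) : Prop :=
  [/\ degree_matrix Q, degree_matrix Q'
    & exists phi : {additive (int * Gam mu)%type -> (int * Gam mu)%type},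
        bijective phi /\ forall i, Q' i = phi (Q i)].

Definition equiv n mu (Q Q' : gmat n mu) : Prop :=
  exists s : 'S_n.+1,
    [/\ degree_matrix Q, forall i, weight Q (s i) = weight Q i
      & row_equiv [ffun i => Q (s i)] Q'].

(* The rows of Q, concatenated: comparing these words lexicographically is the
   row-wise lexicographical comparison of matrices. *)
Definition row_word n mu (Q : gmat n mu) : seqlexi int :=
  [seq nth 0 ((Q i).1 :: [seq k%:Z | k <- residues (Q i).2]) l
     | l <- iota 0 (size mu).+1, i <- enum 'I_n.+1].

Definition row_minimal n mu (Q : gmat n mu) : Prop :=
  forall Q' : gmat n mu, row_equiv Q Q' -> (row_word Q <= row_word Q')%O.

Definition minimal n mu (Q : gmat n mu) : Prop :=
  forall Q' : gmat n mu, equiv Q Q' -> (row_word Q <= row_word Q')%O.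

(* ---- Torsion vectors ---- *)

(* One-row matrices are those of type gmat n [::]. *)
Definition torsion_vector n (w : gmat n [::]) m
    (eta : {ffun 'I_n.+1 -> 'Z_m}) : Prop :=
  degree_matrix (adjoin w eta).

Definition torsion_vector_at_most (v : version) n (w : gmat n [::]) m
    (eta : {ffun 'I_n.+1 -> 'Z_m}) : Prop :=
  degree_matrix_at_most v (adjoin w eta).

Definition torsion_row_equiv n (w : gmat n [::]) m
    (eta eta' : {ffun 'I_n.+1 -> 'Z_m}) : Prop :=
  exists phi : {additive (int * 'Z_m)%type -> (int * 'Z_m)%type},
    bijective phi /\
    forall i, phi (weight w i, eta i) = (weight w i, eta' i).

Definition torsion_word n m (eta : {ffun 'I_n.+1 -> 'Z_m}) : seqlexi nat :=
  [seq nat_of_ord (eta i) | i <- enum 'I_n.+1].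

Definition torsion_row_minimal n (w : gmat n [::]) m
    (eta : {ffun 'I_n.+1 -> 'Z_m}) : Prop :=
  forall eta' : {ffun 'I_n.+1 -> 'Z_m},
    torsion_vector w eta' -> torsion_row_equiv w eta eta' ->
    (torsion_word eta <= torsion_word eta')%O.

(* ---- The procedure ---- *)

(* Matrices with columns in Z x Gamma, with varying Gamma; pairs (eta, mu). *)
Definition tmat (n : nat) : Type := {mu : seq nat & gmat n mu}.
Definition tvec (n : nat) : Type := {m : nat & {ffun 'I_n.+1 -> 'Z_m}}.

Definition tadjoin n (Q : tmat n) (t : tvec n) : tmat n :=
  Tagged (gmat n) (adjoin (tagged Q) (tagged t)).

Definition initial_Q (v : version) n : set (tmat n) :=
  [set Q | exists w : gmat n [::],
     degree_matrix_at_most v w /\ Q = Tagged (gmat n) w].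

Definition initial_M (v : version) n (Q : tmat n) : set (tvec n) :=
  [set t | exists w : gmat n [::],
     [/\ Q = Tagged (gmat n) w, (2 <= tag t)%N,
         torsion_vector_at_most v w (tagged t)
       & torsion_row_minimal w (tagged t)]].

Definition order_bound n (Q : tmat n) : Prop :=
  let w := weight (tagged Q) in
  (\prod_(m <- tag Q) m)%:R <=
    (\sum_i w i)%:~R ^+ n.-1 / (\prod_(i < n) w (lift ord0 i))%:~R :> rat.

Definition next_Q n (Qs : set (tmat n)) (M : tmat n -> set (tvec n)) :
    set (tmat n) :=
  [set R | exists Q t,
     [/\ Qs Q, M Q t, R = tadjoin Q t & minimal (tagged R)]].

Definition next_M (v : version) n (Qs : set (tmat n))
    (M : tmat n -> set (tvec n)) (R : tmat n) : set (tvec n) :=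
  [set t' | exists Q t,
     [/\ Qs Q, M Q t, R = tadjoin Q t, M Q t' &
      [/\ (tag t' %| tag t)%N, order_bound (tadjoin R t'),
          almost_free (tagged (tadjoin R t')),
          degree_matrix_at_most v (tagged (tadjoin R t'))
        & row_minimal (tagged (tadjoin R t'))]]].

Arguments initial_Q : clear implicits.
Arguments initial_M : clear implicits.

(* The set Q_i together with the map M on it. *)
Fixpoint stage (v : version) n (i : nat) :
    set (tmat n) * (tmat n -> set (tvec n)) :=
  if i is j.+1 then
    (next_Q (stage v n j).1 (stage v n j).2,
     next_M v (stage v n j).1 (stage v n j).2)
  else (initial_Q v n, initial_M v n).

Definition calQ (v : version) n (i : nat) : set (tmat n) := (stage v n i).1.
Definition calM (v : version) n (i : nat) : tmat n -> set (tvec n) :=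
  (stage v n i).2.
Arguments calQ : clear implicits.
Arguments calM : clear implicits.

Definition stop (v : version) n (i : nat) : Prop :=
  (forall Q, calQ v n i Q -> calM v n i Q = set0) \/ i = n.-1.

(* The recursion runs through i = 1, 2, ... and N is the first i at which the
   stopping criterion holds. *)
Definition stops_at (v : version) n (N : nat) : Prop :=
  [/\ (1 <= N)%N, stop v n N
    & forall i, (1 <= i < N)%N -> ~ stop v n i].

(* Main.v *)
Require Import Defs.
From HB Require Import structures.
From mathcomp Require Import all_boot all_order all_fingroup all_algebra.
From mathcomp Require Import mathcomp_extra boolp classical_sets cardinality.
From mathcomp Require Import ring lra zify.

(* The output consists of minimal canonical (terminal) degree matrices by
   construction, so the points are completeness, finiteness and termination.

   Completeness.  Deleting a torsion row of the degree matrix Q means passing to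
   a sublattice of Z^n containing all ray generators, which preserves canonicity
   and terminality.  An automorphism (or an equivalence) making the shorter
   matrix smaller extends, by the identity on the deleted row, to one making Q
   smaller; hence the matrix of the first rows of a minimal Q is minimal, and
   deleting a row that is not the last keeps row-minimality.  This gives by
   induction that every minimal Q is reached.

   Order bound and finiteness.  Let beta_i = w_i / h, h = \sum_i w_i, be the
   barycentric coordinates of the origin in the simplex conv(v_0, ..., v_n).
   Canonicity says that the origin is the only interior lattice point.  A
   character of K that kills \sum_i omega_i gives a lattice point with prescribed
   barycentric coordinates modulo 1, so a Minkowski-type averaging argument over
   these |Gam| * h characters yields |Gam| * w_1 ... w_n <= h^(n-1).  Dirichlet
   approximation of the multiples of beta bounds every h / w_i in terms of n, and
   together with the order bound for |Gam| = 1 this bounds h.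

   Termination.  Any n columns generate K; modulo a prime dividing all orders
   this shows that there are at most n - 1 torsion rows. *)
Set Implicit Arguments.
Unset Strict Implicit.
Unset Printing Implicit Defensive.

Import Order.TTheory GRing.Theory Num.Theory.

Local Open Scope ring_scope.

(** * Primitive lattice vectors *)

Lemma dvdz_big_gcdz (I : Type) (F : I -> int) (d : int) (r : seq I) :
  (d %| \big[gcdz/0]_(i <- r) F i)%Z = all (fun i => (d %| F i)%Z) r.
Proof.
by elim: r => [|i r IHr]; rewrite ?big_nil ?dvdz0 // big_cons dvdz_gcd IHr.
Qed.

Lemma big_gcdz_ge0 (I : Type) (F : I -> int) (r : seq I) :
  0 <= \big[gcdz/0]_(i <- r) F i.
Proof. by case: r => [|i r]; rewrite ?big_nil ?big_cons. Qed.

Lemma big_gcdz_dvd n (F : 'I_n -> int) i : (\big[gcdz/0]_(j < n) F j %| F i)%Z.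
Proof.
have := dvdz_big_gcdz F (\big[gcdz/0]_(j < n) F j) (index_enum 'I_n).
by rewrite dvdzz => /esym/allP/(_ i (mem_index_enum i)).
Qed.

Lemma big_gcdz_bezout n (F : 'I_n -> int) :
  exists x : 'I_n -> int, \sum_(i < n) x i * F i = \big[gcdz/0]_(i < n) F i.
Proof.
elim: n F => [|n IHn] F; first by exists (fun=> 0); rewrite !big_ord0.
have [x Hx] := IHn (fun i => F (lift ord0 i)).
have [u [y Hy]] := Bezoutz (F ord0) (\big[gcdz/0]_(i < n) F (lift ord0 i)).
exists (fun i => if unlift ord0 i is Some j then y * x j else u).
rewrite !big_ord_recl unlift_none -Hy; congr (_ + _).
rewrite -Hx mulr_sumr; apply: eq_bigr => i _.
by rewrite liftK mulrA.
Qed.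

Lemma primitive_dvd n (u : 'cV[int]_n) (d : int) :
  primitive u -> (forall i, (d %| u i 0%R)%Z) -> (d %| 1%R)%Z.
Proof.
by move=> u1 du; rewrite -u1 dvdz_big_gcdz; apply/allP => i _; apply: du.
Qed.

Lemma primitiveI n (u : 'cV[int]_n) :
  (forall d : int, (forall i, (d %| u i 0%R)%Z) -> (d %| 1%R)%Z) -> primitive u.
Proof.
move=> H; rewrite /primitive.
have /H := big_gcdz_dvd (fun i => u i 0).
have := big_gcdz_ge0 (fun i => u i 0) (index_enum 'I_n).
case: (\big[_/_]_(i < n) _) => // k _.
rewrite dvdzE dvdn1 => /eqP H1; congr Posz; exact: H1.
Qed.

Lemma primitive_bezout n (u : 'cV[int]_n) :
  primitive u -> exists x : 'cV[int]_n, \sum_i x i 0 * u i 0 = 1.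
Proof.
move=> u1; have [x Hx] := big_gcdz_bezout (fun i => u i 0).
exists (\col_i x i); rewrite -[RHS]u1 -Hx.
by apply: eq_bigr => i _; rewrite mxE.
Qed.

Lemma primitive_part n (u : 'cV[int]_n) : u != 0 ->
  exists2 k : nat, (0 < k)%N &
    exists2 u0 : 'cV[int]_n, primitive u0 & u = k%:Z *: u0.
Proof.
move=> u_neq0; pose g := \big[gcdz/0]_(i < n) u i 0.
have gdvd i : (g %| u i 0%R)%Z by exact: (big_gcdz_dvd (fun i => u i 0)).
have g_neq0 : g != 0.
  apply: contraNneq u_neq0 => g0; apply/eqP/matrixP => i j.
  by rewrite mxE ord1; apply/eqP; rewrite -dvd0z -g0.
have g_ge0 : 0 <= g by exact: big_gcdz_ge0.
have gE : g = `|g|%N%:Z by rewrite gez0_abs.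
exists `|g|%N; first by rewrite absz_gt0.
exists (\col_i (u i 0%R %/ g)%Z).
  apply: primitiveI => d dH; rewrite -(@dvdz_mul2r g) ?g_neq0 //.
  rewrite mul1r {2}/g dvdz_big_gcdz; apply/allP => i _.
  have := dH i; rewrite mxE -(@dvdz_mul2r g) ?g_neq0 //.
  by rewrite divzK.
apply/matrixP => i j; rewrite !mxE ord1 -gE mulrC divzK //.
Qed.

(** * Degree matrices and the interior lattice points of the simplex *)

Lemma Gam_order_kill (mu : seq nat) (g : Gam mu) :
  all (fun m => 2 <= m)%N mu -> g *+ (\prod_(m <- mu) m)%N = 0.
Proof.
elim: mu g => [|m mu IHmu] g /=.
  by move=> _; rewrite big_nil; apply/val_inj; case: (g *+ 1) => -[].
move=> /andP[m_gt1 mu_gt1]; rewrite big_cons.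
apply: injective_projections.
  rewrite (raddfMn fst) /= -mulr_natr natrM pchar_Zp //.
  by rewrite mul0r mulr0.
by rewrite (raddfMn snd) /= mulnC mulrnA IHmu ?mul0rn.
Qed.

Lemma prod_orders_gt0 (mu : seq nat) :
  all (fun m => 2 <= m)%N mu -> (0 < \prod_(m <- mu) m)%N.
Proof.
move=> /allP mu_gt1; rewrite big_seq; apply: prodn_cond_gt0 => m /mu_gt1.
by case: m.
Qed.

Lemma sum_mul_delta (R : pzRingType) (I : finType) (F : I -> R) j :
  \sum_k F k * (k == j)%:R = F j.
Proof.
rewrite (bigD1 j) //= eqxx mulr1 big1 ?addr0 // => i /negPf ->.
by rewrite mulr0.
Qed.

Section DegreeMatrix.

Variables (n : nat) (P : 'M[int]_(n, n.+1)) (mu : seq nat) (Q : gmat n mu).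

Definition wt (i : 'I_n.+1) : rat := (weight Q i)%:~R.
Definition wtsum : rat := \sum_i wt i.

Lemma fst_sum_gmat (c : 'I_n.+1 -> int) :
  (\sum_i Q i *~ c i).1 = \sum_i weight Q i * c i.
Proof.
rewrite (raddf_sum fst); apply: eq_bigr => i _.
by rewrite (raddfMz fst) /= mulrzz.
Qed.

Lemma snd_sum_gmat (c : 'I_n.+1 -> int) :
  (\sum_i Q i *~ c i).2 = \sum_i (Q i).2 *~ c i.
Proof. by rewrite (raddf_sum snd); apply: eq_bigr => i _;
  rewrite (raddfMz snd). Qed.

Lemma fan_dot (x : 'cV[int]_n) (a : 'cV[rat]_n.+1) :
  \sum_i ((P^T *m x) i 0)%:~R * a i 0 =
  \sum_j (x j 0)%:~R * (map_mx intr P *m a) j 0.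
Proof.
transitivity (((map_mx intr (P^T *m x))^T *m a) 0 0).
  by rewrite mxE; apply: eq_bigr => i _; rewrite !mxE.
rewrite map_mxM trmx_mul -map_trmx trmxK -mulmxA mxE.
by apply: eq_bigr => i _; rewrite !mxE.
Qed.

Hypothesis degQ : degree_matrix_of P Q.

Lemma wt_gt0 i : 0 < wt i.
Proof. by case: degQ => _ _ _ w_gt0 _; rewrite ltr0z. Qed.

Lemma wt_ge0 i : 0 <= wt i. Proof. exact/ltW/wt_gt0. Qed.

Lemma wtsum_gt0 : 0 < wtsum.
Proof.
rewrite /wtsum big_ord_recl ltr_wpDr ?wt_gt0 //.
by apply: sumr_ge0 => i _; apply: wt_ge0.
Qed.

Lemma wt_homo (i j : 'I_n.+1) : (i <= j)%N -> wt i <= wt j.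
Proof. by case: degQ => _ _ _ _ w_le ij; rewrite ler_int w_le. Qed.

(** The rows of P are relations among the columns of Q; the degree row of Q turns this into P w =
    0. *)
Lemma mul_fan_wt : map_mx intr P *m (\col_i wt i) = 0.
Proof.
case: degQ => _ _ kerQ _ _; apply/matrixP => j k; rewrite ord1 {k} !mxE.
have /kerQ : exists x, \col_i P j i = P^T *m x.
  exists (delta_mx j 0); apply/matrixP => i k.
  by rewrite ord1 -colE !mxE.
move=> /(congr1 fst); rewrite fst_sum_gmat /= => H0.
transitivity ((\sum_i weight Q i * P j i)%:~R : rat).
  rewrite rmorph_sum /=; apply: eq_bigr => i _.
  by rewrite !mxE rmorphM /= mulrC.
rewrite -[RHS](mulr0z 1); congr (_%:~R); rewrite -[RHS]H0.
by apply: eq_bigr => i _; rewrite mxE.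
Qed.

(** The kernel of P is the line through w: the vector w_j e_i - w_i e_j has degree 0, its multiple
    by |Gam| also has trivial torsion, hence lies in im(P^T), which is orthogonal to a. *)
Lemma fan_ker_wt (a : 'cV[rat]_n.+1) : map_mx intr P *m a = 0 ->
  forall i j, a i 0 * wt j = a j 0 * wt i.
Proof.
move=> Pa0 i j; case: degQ => -[mu_gt1 _] _ kerQ _ _.
pose N : int := (\prod_(m <- mu) m)%N%:Z.
have N_neq0 : N%:~R != 0 :> rat.
  by rewrite intr_eq0 -lt0n prod_orders_gt0.
pose z k : int := weight Q j * (k == i)%:R - weight Q i * (k == j)%:R.
have /kerQ[x xP] : \sum_k Q k *~ (\col_k (N * z k)) k 0 = 0.
  apply: injective_projections.
    rewrite fst_sum_gmat; under eq_bigr do rewrite mxE mulrCA.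
    rewrite -mulr_sumr; under eq_bigr do rewrite mulrBr !mulrA.
    by rewrite sumrB !sum_mul_delta [weight Q i * _]mulrC subrr mulr0.
  rewrite snd_sum_gmat big1 // => k _.
  by rewrite mxE -mulrzA_C -pmulrn Gam_order_kill // mul0rz.
have := fan_dot x a; rewrite -xP Pa0 [RHS]big1 => [|k _]; last first.
  by rewrite mxE mulr0.
under eq_bigr do rewrite mxE rmorphM /= -mulrA.
rewrite -mulr_sumr => /eqP; rewrite mulf_eq0 (negPf N_neq0) /=.
under eq_bigr => k _.
  rewrite rmorphB !rmorphM /= mulrBl -!mulrA ![_%:~R * a k 0]mulrC !mulrA.
  over.
rewrite sumrB /= .
have E (l m : 'I_n.+1) :
    \sum_k (weight Q l)%:~R * a k 0 * (k == m)%:R%:~R = a m 0 * wt l.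
  under eq_bigr => k _ do rewrite natz -pmulrn.
  by rewrite (sum_mul_delta (fun k => (weight Q l)%:~R * a k 0)) mulrC.
by rewrite !E subr_eq0 => /eqP.
Qed.

Hypothesis n_gt0 : (0 < n)%N.

(** P d is a lattice point, and since P w = 0 it has the positive barycentric coordinates w_i / h +
    d_i. So it is an interior lattice point of the simplex, that is, the origin, and the kernel of P
    leaves only d = 0. *)
Lemma fan_no_interior v (d : 'I_n.+1 -> rat) : singularities_at_most v P ->
  \sum_i d i = 0 ->
  (forall c : 'cV[int]_n.+1, \sum_i Q i *~ c i 0 = 0 ->
     \sum_i (c i 0)%:~R * d i \is a Num.int) ->
  (forall i, - (wt i / wtsum) < d i) ->
  forall i, d i = 0.
Proof.
move=> singP sumd0 d_int d_gt; pose a : 'cV[rat]_n.+1 := \col_i d i.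
have wts_gt0 := wtsum_gt0; have wts_neq0 : wtsum != 0 by rewrite gt_eqF.
have Pw0 := mul_fan_wt.
have ker_sum (c : 'cV[rat]_n.+1) i : map_mx intr P *m c = 0 ->
    c i 0 * wtsum = (\sum_j c j 0) * wt i.
  move=> /fan_ker_wt Pc; rewrite mulr_sumr mulr_suml.
  by apply: eq_bigr => j _; apply: Pc.
pose u : 'cV[int]_n := \col_j Num.floor ((map_mx intr P *m a) j 0).
have uE : map_mx intr P *m a = map_mx intr u.
  apply/matrixP => j k; rewrite ord1 {k} [RHS]mxE [u j 0]mxE floorK // mxE.
  rewrite [X in X \is a _](_ : _ = \sum_i ((\col_i P j i) i 0)%:~R * d i).
    apply: d_int; case: degQ => _ _ kerQ _ _; apply/kerQ.
    exists (delta_mx j 0); apply/matrixP => i k.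
    by rewrite ord1 -colE !mxE.
  by apply: eq_bigr => i _; rewrite !mxE.
case: (eqVneq u 0) => [u0|/primitive_part[k k_gt0 [u0 u0_prim uk]]].
  move=> i; have := ker_sum a i; rewrite uE u0 map_mx0 => /(_ erefl)/eqP.
  rewrite (eq_bigr d) => [|j _]; last by rewrite mxE.
  by rewrite sumd0 mul0r mulf_eq0 (negPf wts_neq0) orbF mxE => /eqP.
pose b i := wt i / wtsum + d i.
have b_gt0 i : 0 < b i by rewrite /b addrC -[_ / _]opprK subr_gt0.
have sumb : \sum_i b i = 1.
  by rewrite big_split /= sumd0 addr0 -mulr_suml divff.
(* Subtracting the largest multiple of w that keeps b nonnegative does not change the point and puts
   it in the cone opposite to v_i0. Division by k gives u0 with coordinate sum below 1, a negative
   discrepancy. *)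
case: (@Order.TotalTheory.arg_minP _ _ _ ord0 predT (fun i => b i / wt i)) => // i0 _ i0_min.
set tau := b i0 / wt i0 in i0_min.
have tau_gt0 : 0 < tau by rewrite divr_gt0 ?wt_gt0.
have kR_gt0 : 0 < k%:R :> rat by rewrite ltr0n.
pose a' : 'cV[rat]_n.+1 := \col_i ((b i - tau * wt i) / k%:R).
have a'_ge0 j : 0 <= a' j 0.
  rewrite mxE divr_ge0 ?(ltW kR_gt0) // subr_ge0 -ler_pdivlMr ?wt_gt0 //.
  exact: i0_min.
have suma' : \sum_j a' j 0 < 1.
  under eq_bigr do rewrite mxE.
  rewrite -mulr_suml sumrB sumb -mulr_sumr ltr_pdivrMr // mul1r.
  apply: (@lt_le_trans _ _ 1); last by rewrite ler1n.
  by rewrite gtrBl mulr_gt0.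
have a'_cone : in_max_cone P i0 a' u0.
  split=> //.
    by rewrite mxE /tau divfK ?subrr ?mul0r // gt_eqF // wt_gt0.
  have -> : a' = k%:R^-1 *: (a + (wtsum^-1 - tau) *: (\col_i wt i)).
    apply/matrixP => i j; rewrite !mxE /b; field.
    by rewrite wts_neq0 gt_eqF.
  rewrite -scalemxAr mulmxDr -scalemxAr Pw0 scaler0 addr0 uE uk.
  rewrite map_mxZ scalerA /= -pmulrn mulVf ?scale1r // gt_eqF //.
(* If u0 were v_l, then a' - e_l would be a multiple of w with negative sum, although its entry at
   any i != l is nonnegative; n >= 1 provides such an i. *)
have u0_gen l : u0 <> col l P.
  move=> u0l; have [i i_neq] : exists i : 'I_n.+1, i != l.
    case: (eqVneq ord0 l) => [<-|]; last by exists ord0.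
    by exists ord_max; rewrite -val_eqE /= -lt0n.
  have := ker_sum (a' - delta_mx l 0) i.
  case: a'_cone => _ _ Pa'; rewrite mulmxBr Pa' u0l -colE map_col subrr.
  have E j : (a' - delta_mx l 0) j 0 = a' j 0 - (j == l)%:R.
    by rewrite !mxE eqxx andbT.
  under eq_bigr do rewrite E; rewrite E (negPf i_neq) subr0 sumrB.
  have -> : \sum_j (j == l)%:R = 1 :> rat.
    by have := sum_mul_delta (fun=> 1 : rat) l; under eq_bigr do rewrite mul1r.
  move=> /(_ erefl) {}E; have : 0 <= (\sum_j a' j 0 - 1) * wt i.
    by rewrite -E mulr_ge0 ?(ltW wts_gt0) // a'_ge0.
  by rewrite pmulr_lge0 ?wt_gt0 // subr_ge0 leNgt suma'.
have := singP i0 a' u0 u0_prim u0_gen a'_cone; rewrite /=.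
by case: v {singP} => [|/ltW]; rewrite subr_ge0 leNgt suma'.
Qed.

End DegreeMatrix.

(** * Pigeonhole in boxes *)

Lemma sum_ord_ltn (h w : nat) : (w <= h)%N -> (\sum_(j < h) (j < w) = w)%N.
Proof.
move=> wh; rewrite -(big_mkord xpredT (fun j => nat_of_bool (j < w)%N)).
rewrite (big_cat_nat (leq0n w) wh) /= big_nat.
under eq_bigr => j /andP[_ ->] do [].
rewrite -big_nat sum_nat_const_nat subn0 muln1 big_nat big1 ?addn0 //.
by move=> j /andP[wj _]; rewrite ltnNge wj.
Qed.

(** Membership of F in the cyclic interval {j, ..., j + w - 1} of Z/h. *)
Definition in_window (h w : nat) (F : int) (j : nat) : bool :=
  ((F - j%:Z)%R %% h%:Z)%Z < w%:Z.

(** The involution j |-> (F - j) mod h turns the windows containing F into the residues below w. *)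
Lemma sum_window (h w : nat) (F : int) : (0 < h)%N -> (w <= h)%N ->
  (\sum_(j < h) in_window h w F j = w)%N.
Proof.
move=> h_gt0 wh; have h_neq0 : h%:Z != 0 by rewrite eqz_nat -lt0n.
have tP (j : 'I_h) : (`|((F - j%:Z)%R %% h%:Z)%Z|%N < h)%N.
  by rewrite -ltz_nat gez0_abs ?modz_ge0 // ltz_pmod.
pose t j := Ordinal (tP j).
have tK : involutive t.
  move=> j; apply/val_inj => /=; apply/eqP; rewrite -eqz_nat.
  rewrite !gez0_abs ?modz_ge0 //.
  have := divz_eq (F - j%:Z)%R h%:Z; move: (modz _ _) (divz _ _) => m q Em.
  rewrite (_ : (F - m)%R = q * h%:Z + j%:Z); last by lia.
  by rewrite modzMDl modz_small //= ltz_nat ltn_ord.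
rewrite (reindex_inj (inv_inj tK)) /= -[RHS](sum_ord_ltn wh).
apply: eq_bigr => j _; congr nat_of_bool; rewrite /in_window.
have := congr1 val (tK j) => /= /(congr1 Posz).
by rewrite [in LHS]gez0_abs ?modz_ge0 // => ->.
Qed.

Lemma prod_nat_of_bool (I : finType) (b : I -> bool) :
  (\prod_i b i = [forall i, b i])%N.
Proof.
case: forallP => [b_true|/forallP]; first by rewrite big1 // => i _;
  rewrite b_true.
by rewrite negb_forall => /existsP[i /negPf bi]; rewrite (bigD1 i) //= bi mul0n.
Qed.

(* Averaging over the h^n translates of the box \prod_i [0, w_i / h) by the
   grid (h^-1 Z / Z)^n: some translate contains two of the given points. *)
Lemma box_pigeonhole (n h : nat) (w : 'I_n -> nat) (T : eqType) (s : seq T)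
    (a : T -> 'I_n -> rat) :
  (0 < h)%N -> (forall i, w i <= h)%N -> uniq s ->
  (h ^ n < size s * \prod_i w i)%N ->
  exists x y, [/\ x \in s, y \in s, x != y &
    exists q : 'I_n -> int,
      forall i, `|a x i - a y i - (q i)%:~R| < (w i)%:R / h%:R].
Proof.
move=> h_gt0 wh s_uniq many.
pose F x i : int := Num.floor (h%:R * a x i).
pose c x i (j : 'I_h) : bool := in_window h (w i) (F x i) j.
pose box (f : {ffun 'I_n -> 'I_h}) := [seq x <- s | [forall i, c x i (f i)]].
(* Double counting: every point lies in \prod_i w_i of the h^n translates, so some translate
   contains at least two points. *)
have [f box_f] : exists f, (1 < size (box f))%N.
  apply/existsP; apply: contraTT many; rewrite negb_exists => /forallP box_le.
  rewrite -leqNgt.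
  have -> : (size s * \prod_i w i = \sum_(x <- s) \prod_i w i)%N.
    by rewrite big_const_seq count_predT iter_addn addn0 mulnC.
  rewrite (eq_bigr (fun x => \sum_(f : {ffun 'I_n -> 'I_h}) \prod_i c x i (f i)))%N.
    rewrite exchange_big /= -[X in (X ^ n)%N]card_ord -[X in (_ ^ X)%N]card_ord.
    rewrite -card_ffun -sum1_card; apply: leq_sum => f _.
    under eq_bigr do rewrite prod_nat_of_bool.
    have := box_le f; rewrite -leqNgt size_filter -sum1_count big_mkcond /=.
    by under eq_bigr => x _ do rewrite [if _ then _ else _](_ : _ = [forall i, c x i (f i)] :> nat) //.
  move=> x _; rewrite -(bigA_distr_bigA (fun i j => nat_of_bool (c x i j))).
  by apply: eq_bigr => i _; rewrite sum_window.
have : uniq (box f) by rewrite filter_uniq.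
have box_c z : z \in box f -> (forall i, c z i (f i)) /\ z \in s.
  by rewrite mem_filter => /andP[/forallP].
case: (box f) box_f box_c => [|x [|y r]] //= _ box_c /andP[].
rewrite inE negb_or => /andP[xy _] _.
have [x_box xs] := box_c x (mem_head _ _).
have [y_box ys] : (forall i, c y i (f i)) /\ y \in s.
  by apply: box_c; rewrite !inE eqxx orbT.
exists x, y; split=> //.
exists (fun i => ((F x i - (f i)%:Z)%R %/ h%:Z)%Z - ((F y i - (f i)%:Z)%R %/ h%:Z)%Z).
move=> i; have h_neq0 : h%:Z != 0 by rewrite eqz_nat -lt0n.
have hR_gt0 : 0 < h%:R :> rat by rewrite ltr0n.
have E z : exists2 e : rat, 0 <= e < 1 & h%:R * a z i = (F z i)%:~R + e.
  exists (h%:R * a z i - (F z i)%:~R); last by rewrite addrC subrK.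
  by rewrite subr_ge0 floor_le ltrBlDl -[1]/(1%:~R) -intrD floorD1_gt.
have [e /andP[e_ge0 e_lt1] eE] := E x.
have [e' /andP[e'_ge0 e'_lt1] eE'] := E y.
have := divz_eq (F x i - (f i)%:Z)%R h%:Z;
  have := divz_eq (F y i - (f i)%:Z)%R h%:Z.
have := modz_ge0 (F x i - (f i)%:Z)%R h_neq0;
  have := modz_ge0 (F y i - (f i)%:Z)%R h_neq0.
have := x_box i; have := y_box i; rewrite /c /in_window.
move: (modz _ _) (modz _ _) (divz _ _) (divz _ _) => rx ry qx qy.
move=> ry_lt rx_lt ry_ge0 rx_ge0 Ey Ex.
have Hd : (F x i)%:~R - (F y i)%:~R = (qx - qy)%:~R * h%:R + (rx - ry)%:~R :> rat.
  rewrite -[h%:R]/(h%:Z%:~R) -intrB -intrM -intrD; congr (_%:~R).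
  by rewrite -[F x i](subrK (f i)%:Z) -[F y i](subrK (f i)%:Z) Ex Ey; ring.
(* Two remainders in [0, w) differ by at most w - 1, and the fractional parts lost in the floors
   differ by less than 1; this makes the bound strict. *)
have r_ge : - (w i)%:Z%:~R + 1%:~R <= (rx - ry)%:~R :> rat.
  by rewrite -intrN -intrD ler_int; lia.
have r_le : (rx - ry)%:~R <= (w i)%:Z%:~R - 1%:~R :> rat.
  by rewrite -intrB ler_int; lia.
rewrite -[(w i)%:R]/((w i)%:Z%:~R).
rewrite -(ltr_pM2l hR_gt0) mulrCA divff ?gt_eqF // mulr1 -{1}(gtr0_norm hR_gt0) -normrM.
have -> : h%:R * (a x i - a y i - (qx - qy)%:~R) = (rx - ry)%:~R + (e - e').
  rewrite [in LHS]mulrBr mulrBr eE eE' [h%:R * _]mulrC; move: Hd.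
  by move: (_%:~R * _) (rx - ry)%:~R => A B Hd; lra.
by rewrite ltr_norml; apply/andP; split; lra.
Qed.

(** * Characters of the torsion group *)

(** Characters with values in Q/Z are handled through rational lifts, which are additive only up to
    integers. *)
Lemma additive_mod_int (V : zmodType) (f : V -> rat) (I : finType)
    (g : I -> V) (c : I -> int) :
  (forall x y, f (x + y) - f x - f y \is a Num.int) ->
  f (\sum_i g i *~ c i) - \sum_i (c i)%:~R * f (g i) \is a Num.int.
Proof.
move=> fD.
have f0 : f 0 \is a Num.int.
  by have := fD 0 0; rewrite addr0 subrr sub0r rpredN.
have fN x : f (- x) + f x \is a Num.int.
  have := fD (- x) x; rewrite addNr => H.
  rewrite (_ : _ + _ = f 0 - (f 0 - f (- x) - f x)); first by rewrite rpredB.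
  by ring.
have fn x k : f (x *+ k) - k%:R * f x \is a Num.int.
  elim: k => [|k IHk]; first by rewrite mulr0n mul0r subr0.
  have -> : f (x *+ k.+1) - k.+1%:R * f x =
      (f (x + x *+ k) - f x - f (x *+ k)) + (f (x *+ k) - k%:R * f x).
    by rewrite mulrS -natr1; ring.
  by rewrite rpredD.
have fz x k : f (x *~ k) - k%:~R * f x \is a Num.int.
  case: k => k; first by rewrite -!pmulrn.
  rewrite NegzE mulrNz -pmulrn mulrNz -pmulrn.
  have -> : f (- (x *+ k.+1)) - (- k.+1%:R) * f x =
      (f (- (x *+ k.+1)) + f (x *+ k.+1)) - (f (x *+ k.+1) - k.+1%:R * f x).
    by ring.
  by rewrite rpredB.
elim: (index_enum I) => [|i r IHr]; first by rewrite !big_nil subr0.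
rewrite !big_cons; set G := \sum_(j <- r) _; set F := \sum_(j <- r) _.
have -> : f (g i *~ c i + G) - ((c i)%:~R * f (g i) + F) =
   (f (g i *~ c i + G) - f (g i *~ c i) - f G)
   + (f (g i *~ c i) - (c i)%:~R * f (g i)) + (f G - F) by ring.
apply: rpredD; last exact: IHr.
by apply: rpredD; [exact: fD | exact: fz].
Qed.

(* Up to integers this is the perfect pairing Gam mu x Gam mu -> Q / Z; its
   values give the characters of Gam mu. *)
Fixpoint Gam_pair (mu : seq nat) : Gam mu -> Gam mu -> rat :=
  match mu with
  | [::] => fun _ _ => 0
  | m :: _ => fun x g =>
      (nat_of_ord x.1)%:R * (nat_of_ord g.1)%:R / m%:R + Gam_pair x.2 g.2
  end.

Lemma Gam_pair0 mu (x : Gam mu) : Gam_pair x 0 = 0.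
Proof. by elim: mu x => //= m mu IHmu x; rewrite IHmu mulr0 mul0r addr0. Qed.

Lemma Gam_pairD mu (x g g' : Gam mu) : all (fun m => 2 <= m)%N mu ->
  Gam_pair x (g + g') - Gam_pair x g - Gam_pair x g' \is a Num.int.
Proof.
elim: mu x g g' => [|m mu IHmu] x g g' /=; first by rewrite !subr0.
move=> /andP[m_gt1 mu_gt1].
have m_neq0 : m%:R != 0 :> rat by rewrite pnatr_eq0;
  case: m m_gt1 {x g g' IHmu}.
have modE (a : nat) : (a %% (Zp_trunc m).+2 = a %% m)%N by rewrite Zp_cast.
rewrite modE; have := divn_eq (nat_of_ord g.1 + nat_of_ord g'.1) m;
  set q := (_ %/ m)%N; set r := (_ %% m)%N => E.
have {}E : r%:R = (nat_of_ord g.1)%:R + (nat_of_ord g'.1)%:R - q%:R * m%:R :> rat.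
  by rewrite -natrD E natrD natrM addrC addKr.
rewrite E [X in X \is a _](_ : _ = - ((nat_of_ord x.1)%:R * q%:R) +
  (Gam_pair x.2 (g.2 + g'.2) - Gam_pair x.2 g.2 - Gam_pair x.2 g'.2)).
  by rewrite rpredD ?IHmu // rpredN rpredM ?natr_int.
by field.
Qed.

Lemma int_lt_eq (m x y : nat) : (x < m)%N -> (y < m)%N ->
  (x%:R - y%:R) / m%:R \is a (@Num.int rat) -> x = y.
Proof.
move=> xm ym /intrP[k]; have m_gt0 : 0 < m%:R :> rat by rewrite ltr0n; lia.
move=> /(canRL (divfK (lt0r_neq0 m_gt0))).
rewrite -[x%:R]/(x%:Z%:~R) -[y%:R]/(y%:Z%:~R) -[m%:R]/(m%:Z%:~R).
rewrite -intrB -intrM => /intr_inj E.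
have k_lt1 : k < 1 by rewrite ltNge; apply/negP => k1; nia.
have k_gtN1 : -1 < k by rewrite ltNge; apply/negP => k1; nia.
have k0 : k = 0 by lia.
by move: E; rewrite k0 mul0r; lia.
Qed.

Lemma Gam_pair_inj mu (x y : Gam mu) : all (fun m => 2 <= m)%N mu ->
  (forall g, Gam_pair x g - Gam_pair y g \is a Num.int) -> x = y.
Proof.
elim: mu x y => [|m mu IHmu] x y /=.
  by move=> _ _; apply/val_inj; case: x => -[|//] ?; case: y => -[].
move=> /andP[m_gt1 mu_gt1] H; apply: injective_projections.
  have ltm (z : 'Z_m) : (z < m)%N by rewrite -[X in (_ < X)%N]Zp_cast.
  (* The generator of the first factor compares two residues below m modulo m. *)
  have := H (1, 0); rewrite /= !Gam_pair0 !addr0 modn_small ?Zp_cast //.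
  rewrite !mulr1 -mulrBl => /(int_lt_eq (ltm x.1) (ltm y.1)) xy.
  exact: val_inj.
apply: IHmu => // g; have := H (0, g).
by rewrite /= !mulr0 !mul0r !add0r.
Qed.

Fixpoint Gam_enum (mu : seq nat) : seq (Gam mu) :=
  match mu with
  | [::] => [:: 0]
  | m :: mu' => [seq (x, g) | x <- enum 'Z_m, g <- Gam_enum mu']
  end.

Lemma size_Gam_enum mu : all (fun m => 2 <= m)%N mu ->
  size (Gam_enum mu) = (\prod_(m <- mu) m)%N.
Proof.
elim: mu => [|m mu IHmu] /=; first by rewrite big_nil.
move=> /andP[m_gt1 mu_gt1].
by rewrite size_allpairs size_enum_ord Zp_cast // big_cons IHmu.
Qed.

Lemma Gam_enum_uniq mu : uniq (Gam_enum mu).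
Proof.
elim: mu => [|m mu IHmu] //=.
by apply: allpairs_uniq; rewrite ?enum_uniq // => -[? ?] [? ?] _ _ [-> ->].
Qed.

(** * The order bound and the bound on the weights *)

Section OrderBound.

Variables (v : version) (n : nat) (P : 'M[int]_(n, n.+1)) (mu : seq nat).
Variable Q : gmat n mu.
Hypotheses (n_gt0 : (0 < n)%N) (singP : singularities_at_most v P).
Hypothesis degQ : degree_matrix_of P Q.

Definition natwt (i : 'I_n.+1) : nat := `|weight Q i|%N.
Definition natwtsum : nat := (\sum_i natwt i)%N.

Lemma natwtE i : (natwt i)%:Z = weight Q i.
Proof. by case: degQ => _ _ _ w_gt0 _; rewrite gez0_abs ?ltW. Qed.

Lemma wt_natwt i : wt Q i = (natwt i)%:R.
Proof. by rewrite /wt -natwtE. Qed.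

Lemma wtsum_natwtsum : wtsum Q = natwtsum%:R.
Proof. by rewrite natr_sum; apply: eq_bigr => i _; apply: wt_natwt. Qed.

Lemma natwt_gt0 i : (0 < natwt i)%N.
Proof. by rewrite -(ltr0n rat) -wt_natwt (wt_gt0 degQ). Qed.

Lemma natwtsum_gt0 : (0 < natwtsum)%N.
Proof. by rewrite -(ltr0n rat) -wtsum_natwtsum (wtsum_gt0 degQ). Qed.

Lemma leq_natwtsum i : (natwt i <= natwtsum)%N.
Proof. by rewrite /natwtsum (bigD1 i) //= leq_addr. Qed.

Lemma leq_natwt (i j : 'I_n.+1) : (i <= j)%N -> (natwt i <= natwt j)%N.
Proof. by move=> ij; rewrite -(ler_nat rat) -!wt_natwt (wt_homo degQ). Qed.

(* If the bound fails, two of the |Gam mu| * h characters of Z x Gam mu that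
   kill the sum of the omega_i are close in the coordinates 1, ..., n; the sign
   of their difference is then chosen such that coordinate 0 is positive. *)
Lemma fan_order_bound :
  (\prod_(m <- mu) m * \prod_(i < n) natwt (lift ord0 i) <= natwtsum ^ n.-1)%N.
Proof.
rewrite leqNgt; apply/negP => big.
set h := natwtsum in big; have h_gt0 : (0 < h)%N by exact: natwtsum_gt0.
have hR_neq0 : h%:R != 0 :> rat by rewrite pnatr_eq0 -lt0n.
have [[mu_gt1 _] genQ _ _ _] := degQ.
(* A pair (g, k) encodes the character with torsion part [Gam_pair g] and value t on (1, 0), where h
   t + S g = k makes it integral on \sum_i omega_i. [A (g, k) i] is its value on omega_i. *)
pose S g := \sum_i Gam_pair g (Q i).2.
pose t (x : Gam mu * nat) := (x.2%:R - S x.1) / h%:R.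
pose A x i := t x * wt Q i + Gam_pair x.1 (Q i).2.
have sumA x : \sum_i A x i = x.2%:R.
  rewrite big_split /= -mulr_sumr -/(wtsum Q) wtsum_natwtsum divfK //.
  by rewrite subrK.
have A_ker x (c : 'cV[int]_n.+1) : \sum_i Q i *~ c i 0 = 0 ->
    \sum_i (c i 0)%:~R * A x i \is a Num.int.
  move=> Qc0; have := additive_mod_int (fun i => (Q i).2) (fun i => c i 0)
     (fun g g' => Gam_pairD x.1 g g' mu_gt1).
  rewrite -snd_sum_gmat Qc0 Gam_pair0 sub0r rpredN.
  under [X in _ -> X \is a _]eq_bigr do rewrite mulrDr mulrCA.
  rewrite big_split /= -mulr_sumr.
  suff -> : \sum_i (c i 0)%:~R * wt Q i = 0 by rewrite mulr0 add0r.
  have := congr1 fst Qc0;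
    rewrite fst_sum_gmat /= => /(congr1 (intr : int -> rat)).
  by rewrite rmorph_sum => E; rewrite -[RHS]E; apply: eq_bigr => i _;
    rewrite rmorphM mulrC.
pose s := [seq (g, k) | g <- Gam_enum mu, k <- iota 0 h].
have s_uniq : uniq s.
  by apply: allpairs_uniq; rewrite ?Gam_enum_uniq ?iota_uniq // => -[? ?] [? ?].
have many : (h ^ n < size s * \prod_i natwt (lift ord0 i))%N.
  rewrite size_allpairs size_iota size_Gam_enum // -{1}(prednK n_gt0) expnS.
  by rewrite mulnAC mulnC ltn_mul2r h_gt0.
have [x [y [xs ys xy [q q_close]]]] := box_pigeonhole
  (fun x (i : 'I_n) => A x (lift ord0 i)) h_gt0
  (fun i => leq_natwtsum (lift ord0 i)) s_uniq many.
have s_lt z : z \in s -> (z.2 < h)%N.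
  by case/allpairsP => -[g k] [_]; rewrite mem_iota => /andP[_ kh] ->.
(* d is A x - A y reduced by integers: coordinates 1, ..., n become small, and coordinate 0 is fixed
   by requiring sum 0. It stays congruent to the original because the sums of A x and A y are
   integers. *)
pose e (j : 'I_n) := A x (lift ord0 j) - A y (lift ord0 j) - (q j)%:~R.
pose d i := if unlift ord0 i is Some j then e j else - \sum_j e j.
have d0 : d ord0 = - \sum_j e j by rewrite /d unlift_none.
have dS j : d (lift ord0 j) = e j by rewrite /d liftK.
have sumd : \sum_i d i = 0.
  by rewrite big_ord_recl; under eq_bigr do rewrite dS; rewrite d0 addNr.
have dA i : d i - (A x i - A y i) \is a Num.int.
  case: (unliftP ord0 i) => [j|] ->; rewrite ?dS ?d0.
    by rewrite /e addrAC subrr add0r rpredN intr_int.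
  rewrite [X in X \is a _](_ : _ = \sum_j (q j)%:~R - (x.2%:R - y.2%:R)).
    by rewrite !rpredB ?natr_int // rpred_sum // => j _; apply: intr_int.
  by rewrite -!sumA !big_ord_recl sumrB sumrB; ring.
have d_ker (c : 'cV[int]_n.+1) : \sum_i Q i *~ c i 0 = 0 ->
    \sum_i (c i 0)%:~R * d i \is a Num.int.
  move=> Qc0.
  rewrite (_ : \sum_i _ = \sum_i (c i 0)%:~R * (d i - (A x i - A y i)) +
     (\sum_i (c i 0)%:~R * A x i - \sum_i (c i 0)%:~R * A y i)).
    rewrite rpredD ?rpredB ?A_ker //; apply: rpred_sum => i _.
    by rewrite rpredM ?intr_int.
  by rewrite -sumrB -big_split /=; apply: eq_bigr => i _; ring.
have d_small j : `|d (lift ord0 j)| < wt Q (lift ord0 j) / wtsum Q.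
  by rewrite dS wt_natwt wtsum_natwtsum; apply: q_close.
have wb_gt0 : 0 < wt Q ord0 / wtsum Q by rewrite divr_gt0 ?(wt_gt0 degQ) ?(wtsum_gt0 degQ).
have d_eq0 i : d i = 0.
  have [d0_ge0|d0_lt0] := leP 0 (d ord0).
    apply: (fan_no_interior degQ n_gt0 singP) => // {}i.
    case: (unliftP ord0 i) => [j|] ->; last by lra.
    by have := d_small j; rewrite ltr_norml => /andP[].
  apply/eqP; rewrite -oppr_eq0; apply/eqP.
  apply: (fan_no_interior degQ n_gt0 singP (d := fun i => - d i)) => [|c Qc0|{}i].
  - by rewrite sumrN sumd oppr0.
  - by under eq_bigr do rewrite mulrN; rewrite sumrN rpredN d_ker.
  case: (unliftP ord0 i) => [j|] ->; last by lra.
  by have := d_small j; rewrite ltr_norml ltrN2 => /andP[].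
(* The difference of the two characters is integral on every omega_i, hence everywhere; its values
   at (0, g) and (1, 0) force x = y. *)
pose f (g : int * Gam mu) :=
  (t x - t y) * g.1%:~R + (Gam_pair x.1 g.2 - Gam_pair y.1 g.2).
have f_int g : f g \is a Num.int.
  have [c <-] := genQ g.
  have fD a b : f (a + b) - f a - f b \is a Num.int.
    rewrite [X in X \is a _](_ : _ =
      (Gam_pair x.1 (a.2 + b.2) - Gam_pair x.1 a.2 - Gam_pair x.1 b.2) -
      (Gam_pair y.1 (a.2 + b.2) - Gam_pair y.1 a.2 - Gam_pair y.1 b.2)).
      by rewrite rpredB ?Gam_pairD.
    by rewrite /f /= intrD; ring.
  rewrite -[X in X \is a _](subrK (\sum_i (c i)%:~R * f (Q i))) rpredD ?additive_mod_int //.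
  apply: rpred_sum => i _; rewrite rpredM ?intr_int //.
  have -> : f (Q i) = A x i - A y i by rewrite /f /A /wt /weight; ring.
  by have := dA i; rewrite d_eq0 sub0r rpredN.
have xy1 : x.1 = y.1.
  apply: (Gam_pair_inj mu_gt1) => g; have := f_int (0, g).
  by rewrite /f /= mulr0 add0r.
have xy2 : x.2 = y.2.
  apply: (int_lt_eq (s_lt _ xs) (s_lt _ ys)); have := f_int (1, 0).
  have -> : (x.2%:R - y.2%:R) / h%:R = t x - t y by rewrite /t xy1; field.
  by rewrite /f /= !Gam_pair0 subrr addr0 mulr1.
by case/eqP: xy; case: x y xy1 xy2 {xs ys q_close e d d0 dS sumd dA d_ker d_small d_eq0 f f_int} => [? ?] [? ?] /= -> ->.
Qed.

Lemma int_small_eq0 (x : rat) : x \is a Num.int -> `|x| < 1 -> x = 0.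
Proof.
by move=> /intrP[k ->]; rewrite -intr_norm -[1]/(1%:~R) ltr_int => k1;
  have -> : k = 0 by lia.
Qed.

(* Dirichlet approximation of the barycentric coordinates w_i / h that are not
   too small, by a multiplier kappa: the other coordinates, multiplied by
   kappa, would remain small if they were smaller than stated. *)
Lemma fan_natwt_gap (r : nat) (j : 'I_n.+1) :
  (2 * n.+1 <= r)%N ->
  (forall i : 'I_n.+1, (j < i)%N -> natwtsum <= r * natwt i)%N ->
  (natwtsum <= 2 * n.+1 * r ^ n.+1 * natwt j)%N.
Proof.
move=> r_ge large; rewrite leqNgt; apply/negP => small.
have r_gt0 : (0 < r)%N by apply: leq_trans r_ge.
have rR_gt0 : 0 < r%:R :> rat by rewrite ltr0n.
have nR_gt0 : 0 < (2 * n.+1)%:R :> rat by rewrite ltr0n.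
have hR_gt0 := wtsum_gt0 degQ.
pose b i := wt Q i / wtsum Q.
have b_gt0 i : 0 < b i by rewrite divr_gt0 ?(wt_gt0 degQ).
have [k [q [k_gt0 k_le close]]] : exists (k : nat) (q : 'I_n.+1 -> int),
    [/\ 0 < k, k <= r ^ n.+1 &
     forall i : 'I_n.+1, j < i -> (`|k%:R * b i - (q i)%:~R| < r%:R^-1)%R]%N.
  (* Coordinates up to j are set to 0 so that they impose no condition; r^(n+1) + 1 multiples
     compete for boxes of side 1/r. *)
  pose a (k : nat) (i : 'I_n.+1) : rat := if (j < i)%N then k%:R * b i else 0.
  have many : (r ^ n.+1 < size (iota 0 (r ^ n.+1).+1) * \prod_(i < n.+1) 1)%N.
    by rewrite size_iota big1 // muln1.
  have [x [y [xs ys xy [q q_close]]]] := box_pigeonhole a r_gt0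
    (fun=> r_gt0) (iota_uniq _ _) many.
  move: xs ys; rewrite !mem_iota !add0n !ltnS /= => xr yr.
  move: xy; rewrite neq_ltn => /orP[xy|yx].
    exists (y - x)%N, (fun i => - q i); split; rewrite ?subn_gt0 //.
      by apply: leq_trans yr; apply: leq_subr.
    move=> i ji; have := q_close i; rewrite /a ji div1r; rewrite -normrN.
    rewrite natrB ?(ltnW xy) // intrN.
    suff -> : (y%:R - x%:R) * b i - - (q i)%:~R =
        - (x%:R * b i - y%:R * b i - (q i)%:~R) by [].
    by ring.
  exists (x - y)%N, q; split; rewrite ?subn_gt0 //.
    by apply: leq_trans xr; apply: leq_subr.
  move=> i ji; have := q_close i; rewrite /a ji div1r.
  by rewrite natrB ?(ltnW yx) // mulrBl.
pose q' (i : 'I_n.+1) : int := if (j < i)%N then q i else 0.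
(* d pairs integrally with all relations because b is proportional to w. Nothing is subtracted up to
   j, so d is positive there, which will contradict d = 0. *)
pose d i := k%:R * b i - (q' i)%:~R.
have dl (i : 'I_n.+1) : (j < i)%N -> `|d i| < r%:R^-1.
  by move=> ji; rewrite /d /q' ji; apply: close.
have ds (i : 'I_n.+1) : (i <= j)%N -> d i = k%:R * b i.
  by move=> ij; rewrite /d /q' ltnNge ij /= subr0.
have ds_gt0 (i : 'I_n.+1) : (i <= j)%N -> 0 < d i.
  by move=> ij; rewrite ds // mulr_gt0 // ltr0n.
have d_lt i : `|d i| < (2 * n.+1)%:R^-1.
  have [ij|ji] := leqP i j; last first.
    by apply: lt_le_trans (dl i ji) _; rewrite lef_pV2 ?posrE // ler_nat.
  rewrite gtr0_norm ?ds_gt0 // ds // /b mulrA ltr_pdivrMr // ltr_pdivlMl //.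
  rewrite wtsum_natwtsum wt_natwt -!natrM ltr_nat; apply: leq_ltn_trans small.
  by rewrite -[X in (_ <= X)%N]mulnA leq_mul2l leq_mul ?orbT // leq_natwt.
(* The sum is an integer because the b_i sum to 1, and n + 1 terms of absolute value below 1 / (2(n
   + 1)) keep it inside (-1, 1). *)
have sumd : \sum_i d i = 0.
  apply: int_small_eq0.
    rewrite sumrB -mulr_sumr -mulr_suml divff ?gt_eqF // mulr1.
    by rewrite rpredB ?natr_int // rpred_sum // => i _; apply: intr_int.
  apply: le_lt_trans (ler_norm_sum _ _ _) _.
  apply: (@le_lt_trans _ _ (\sum_(i < n.+1) (2 * n.+1)%:R^-1)).
    by apply: ler_sum => i _; apply/ltW.
  rewrite sumr_const card_ord -[X in X < _]mulr_natl ltr_pdivrMr // mul1r ltr_nat.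
  by rewrite mul2n -addnn -[X in (X < _)%N]addn0 ltn_add2l.
have d_ker (c : 'cV[int]_n.+1) : \sum_i Q i *~ c i 0 = 0 ->
    \sum_i (c i 0)%:~R * d i \is a Num.int.
  move=> Qc0; rewrite (_ : \sum_i _ = - \sum_i (c i 0)%:~R * (q' i)%:~R).
    by rewrite rpredN rpred_sum // => i _; rewrite rpredM ?intr_int.
  have := congr1 fst Qc0;
    rewrite fst_sum_gmat /= => /(congr1 (intr : int -> rat)).
  rewrite rmorph_sum /= => Ew; apply/eqP; rewrite -subr_eq0 opprK -big_split /=.
  rewrite (eq_bigr (fun i => k%:R / wtsum Q * (weight Q i * c i 0)%:~R)).
    by rewrite -mulr_sumr Ew mulr0.
  by move=> i _; rewrite /d /b /wt rmorphM /=; ring.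
suff d_eq0 : d j = 0 by have := ds_gt0 j (leqnn j); rewrite d_eq0 ltxx.
apply: (fan_no_interior degQ n_gt0 singP sumd d_ker) => i.
have [ij|ji] := leqP i j.
  by apply: lt_trans (ds_gt0 i ij); rewrite oppr_lt0 b_gt0.
have := dl i ji; rewrite ltr_norml => /andP[+ _]; apply: le_lt_trans.
rewrite lerN2 ler_pdivlMr // ler_pdivrMl // wtsum_natwtsum wt_natwt.
by rewrite -natrM ler_nat large.
Qed.

(** Bounds h / w_i for i >= n - k by iterating the gap estimate downwards from the largest weight,
    which is at least h / (n + 1). *)
Fixpoint weight_ratio (k : nat) : nat :=
  if k is k'.+1 then (2 * n.+1 * weight_ratio k' ^ n.+1)%N else (2 * n.+1)%N.

Lemma weight_ratio_ge k : (2 * n.+1 <= weight_ratio k)%N.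
Proof.
elim: k => [|k IHk] //=; rewrite leq_pmulr // expn_gt0.
by rewrite (leq_trans _ IHk).
Qed.

Lemma natwtsum_le_ratio k (i : 'I_n.+1) :
  (n - k <= i)%N -> (natwtsum <= weight_ratio k * natwt i)%N.
Proof.
elim: k i => [|k IHk] i.
  rewrite subn0 => ni; have {ni}-> : i = ord_max.
    by apply/val_inj/anti_leq; rewrite ni -ltnS ltn_ord.
  apply: (@leq_trans (n.+1 * natwt ord_max)); last first.
    by rewrite leq_mul2r /= leq_pmull ?orbT.
  rewrite -[X in (X * _)%N]card_ord -sum_nat_const; apply: leq_sum => l _.
  by rewrite leq_natwt // -ltnS ltn_ord.
move=> ki; apply: fan_natwt_gap; first exact: weight_ratio_ge.
by move=> l il; apply: IHk; apply: leq_trans il; lia.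
Qed.

(** Multiplying the bounds on h / w_i over i = 1, ..., n and inserting the order bound \prod_i w_i
    <= h^(n-1) cancels all but one factor h. *)
Lemma fan_natwtsum_le : mu = [::] -> (natwtsum <= weight_ratio n ^ n)%N.
Proof.
move=> mu0; have := fan_order_bound; rewrite mu0 big_nil mul1n => prod_le.
have h_gt0 := natwtsum_gt0.
rewrite -(leq_pmul2r (m := natwtsum ^ n.-1)) ?expn_gt0 ?h_gt0 //.
rewrite -expnS prednK //; apply: leq_trans (leq_mul (leqnn _) prod_le).
have -> : (weight_ratio n ^ n = \prod_(i < n) weight_ratio n)%N.
  by rewrite prod_nat_const card_ord.
rewrite -big_split /= -[X in (_ ^ X)%N](card_ord n) -prod_nat_const.
by apply: leq_prod => i _; apply: natwtsum_le_ratio; rewrite subnn.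
Qed.

End OrderBound.

Lemma order_bound_at_most v n mu (Q : gmat n mu) : (0 < n)%N ->
  degree_matrix_at_most v Q -> order_bound (Tagged (gmat n) Q).
Proof.
move=> n_gt0 [P [_ singP degQ]]; rewrite /order_bound /=.
have prod_gt0 : (0 < \prod_(i < n) natwt Q (lift ord0 i))%N.
  by apply: prodn_gt0 => i; apply: natwt_gt0 degQ _.
have -> : \prod_(i < n) weight Q (lift ord0 i) =
    (\prod_(i < n) natwt Q (lift ord0 i))%N%:Z.
  by rewrite (big_morph Posz PoszM (erefl _)); apply: eq_bigr => i _;
    rewrite (natwtE degQ).
have -> : \sum_i weight Q i = (natwtsum Q)%:Z.
  by rewrite (big_morph Posz PoszD (erefl _)); apply: eq_bigr => i _;
    rewrite (natwtE degQ).
rewrite -!pmulrn ler_pdivlMr ?ltr0n // -natrX -natrM ler_nat.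
exact: fan_order_bound n_gt0 singP degQ.
Qed.

(** * Quotients of degree matrices *)

Lemma fan_row_free n (P : 'M[int]_(n, n.+1)) : fwps_fan P ->
  row_free (map_mx intr P : 'M[rat]_(n, n.+1)).
Proof.
move=> [_ span]; apply/row_freeP.
have /boolp.choice[a aP] : forall j : 'I_n, exists a : 'cV[rat]_n.+1,
    map_mx intr P *m a = delta_mx j 0.
  by move=> j; have [a [_ aP]] := span (delta_mx j 0); exists a.
exists (\matrix_(i, j) a j i 0); apply/matrixP => i j.
have := congr1 (fun M : 'cV_n => M i 0) (aP j); rewrite !mxE eqxx andbT => <-.
by apply: eq_bigr => k _; rewrite !mxE.
Qed.

Lemma singular_lattice_basis n (B : 'M[int]_n.+1) : \det B = 0 ->
  exists C : 'M[int]_(n.+1, n), forall c : 'cV[int]_n.+1,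
    (exists z, c = B *m z) <-> (exists x, c = C *m x).
Proof.
have [L L_unit [R R_unit [d d_sorted BE]]] := int_Smith_normal_form B.
set D := \matrix_(i, j) _ in BE => detB.
have DE : D = diag_mx (\row_i d`_i).
  by apply/matrixP => i j; rewrite !mxE.
have dn0 : d`_n = 0.
  move: detB; rewrite BE !det_mulmx DE det_diag => /eqP.
  rewrite !mulf_eq0 -orbA => /or3P[/eqP L0||/eqP R0].
  - by move: L_unit; rewrite unitmxE L0 unitr0.
  - move=> /prodf_eq0[i _]; rewrite mxE => /eqP di0.
    have [szd|nd] := leqP (size d) n; first by rewrite nth_default.
    apply/eqP; rewrite -dvd0z -[X in (X %| _)%Z]di0.
    have i_n : (i <= n)%N by rewrite -ltnS.
    apply: (@sorted_leq_nth _ dvdz _ dvdzz 0 d d_sorted) => //.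
      by move=> ? ? ?; apply: dvdz_trans.
    by rewrite inE (leq_ltn_trans i_n).
  by move: R_unit; rewrite unitmxE R0 unitr0.
pose wid := widen_ord (leqnSn n).
have DM (z : 'cV[int]_n.+1) :
    D *m z = (\matrix_(i, j) D i (wid j)) *m (\col_j z (wid j) 0).
  apply/matrixP => i j; rewrite ord1 !mxE big_ord_recr /=.
  rewrite [X in _ + X](_ : _ = 0).
    by rewrite addr0; apply: eq_bigr => k _; rewrite !mxE.
  rewrite mxE; case: eqP => [->|_]; last by rewrite mulr0n mul0r.
  by rewrite /= dn0 mul0rn mul0r.
exists (L *m \matrix_(i, j) D i (wid j)) => c; split=> [[z ->]|[x ->]].
  by exists (\col_j (R *m z) (wid j) 0); rewrite BE -!mulmxA DM.
pose z : 'cV[int]_n.+1 :=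
  \col_i (if insub (val i) is Some j then x j 0 else 0).
exists (invmx R *m z); rewrite BE -!mulmxA mulKVmx // DM.
congr (_ *m (_ *m _)); apply/matrixP => j k; rewrite ord1 !mxE.
by rewrite (_ : val (wid j) = val j) // valK.
Qed.

Lemma sum_gmat_additive n mu mu' (Q : gmat n mu)
    (pi : {additive (int * Gam mu)%type -> (int * Gam mu')%type})
    (c : 'I_n.+1 -> int) :
  \sum_i [ffun i => pi (Q i)] i *~ c i = pi (\sum_i Q i *~ c i).
Proof. by rewrite raddf_sum; apply: eq_bigr => i _; rewrite ffunE raddfMz. Qed.

(* Dropping a torsion row means dividing K by a cyclic subgroup, that is,
   passing to a sublattice of Z^n that still contains the ray generators. *)
Lemma degree_matrix_at_most_quotient v n mu mu' (Q : gmat n mu)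
    (pi : {additive (int * Gam mu)%type -> (int * Gam mu')%type})
    (g0 : int * Gam mu) :
  (0 < n)%N -> torsion_orders mu' -> (forall g, (pi g).1 = g.1) ->
  (forall g', exists g, pi g = g') ->
  pi g0 = 0 -> (forall g, pi g = 0 -> exists k : int, g = g0 *~ k) ->
  degree_matrix_at_most v Q -> degree_matrix_at_most v [ffun i => pi (Q i)].
Proof.
move=> n_gt0 mu'_ord pi1 pi_surj pi_g0 ker_pi [P [fanP singP degQ]].
have [mu_ord genQ kerQ w_gt0 w_le] := degQ.
have [y yE] := genQ g0.
(* The relations among the pi (omega_i) are generated by those of Q and by the coefficients y of g0.
   These n + 1 vectors are all orthogonal to w, since g0 has degree 0, so n generators suffice. *)
pose B : 'M[int]_(n.+1, 1 + n) := row_mx (\col_i y i) P^T.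
have detB : \det (B : 'M_n.+1) = 0.
  apply/eqP; rewrite -(intr_eq0 rat) -det_map_mx; apply/det0P.
  exists (\row_i wt Q i).
    apply/eqP => /matrixP/(_ 0 ord0); rewrite !mxE => /eqP.
    by rewrite gt_eqF // (wt_gt0 degQ).
  transitivity ((\row_i wt Q i) *m
      row_mx (map_mx intr (\col_i y i)) (map_mx intr P^T)).
    by rewrite -map_row_mx.
  rewrite mul_mx_row [X in row_mx X](_ : _ = 0); last first.
    apply/matrixP => i j; rewrite !mxE.
    have := congr1 fst yE; rewrite fst_sum_gmat -pi1 pi_g0 /=.
    move=> /(congr1 (intr : int -> rat)); rewrite rmorph_sum => Ey.
    rewrite -[RHS]Ey; apply: eq_bigr => k _.
    by rewrite !mxE rmorphM.
  rewrite -map_trmx -[X in row_mx _ X]trmxK trmx_mul trmxK.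
  rewrite (_ : (\row_i _)^T = \col_i wt Q i); last first.
    by apply/matrixP => i j; rewrite !mxE.
  by rewrite (mul_fan_wt degQ) trmx0 row_mx0.
have kerB (c : 'cV[int]_n.+1) : \sum_i [ffun i => pi (Q i)] i *~ c i 0 = 0 <->
    exists z, c = B *m z.
  rewrite (sum_gmat_additive Q pi (fun i => c i 0)).
  have BE (k : int) (x : 'cV[int]_n) : B *m col_mx k%:M x = k *: (\col_i y i) + P^T *m x.
    by rewrite mul_row_col mul_mx_scalar.
  have QB (k : int) (x : 'cV[int]_n) :
      \sum_i Q i *~ (B *m col_mx k%:M x) i 0 = g0 *~ k.
    have /kerQ Qx : exists x', P^T *m x = P^T *m x' by exists x.
    rewrite -yE BE -[RHS]addr0 -[X in _ = _ + X]Qx mulrz_suml -big_split /=.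
    by apply: eq_bigr => i _; rewrite !mxE mulrzDr mulrzA_C.
  split=> [/ker_pi[k Qc]|[z ->]].
    have /kerQ[x xE] : \sum_i Q i *~ (c - k *: (\col_i y i)) i 0 = 0.
      transitivity (\sum_i Q i *~ c i 0 - (\sum_i Q i *~ y i) *~ k).
        rewrite mulrz_suml -sumrB; apply: eq_bigr => i _.
        by rewrite !mxE mulrzBr mulrzA_C.
      by rewrite yE Qc subrr.
    by exists (col_mx k%:M x); rewrite BE -xE addrC subrK.
  rewrite -[z](@vsubmxK _ 1) [usubmx _]mx11_scalar QB.
  by rewrite raddfMz pi_g0 mul0rz.
have [C CE] := singular_lattice_basis detB.
have kerC (c : 'cV[int]_n.+1) : \sum_i [ffun i => pi (Q i)] i *~ c i 0 = 0 <->
   exists x : 'cV[int]_n, c = (C^T)^T *m x.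
  rewrite trmxK; split=> [H|H].
    exact: (proj1 (CE c) (proj1 (kerB c) H)).
  exact: (proj2 (kerB c) (proj2 (CE c) H)).
(* A embeds the new lattice into the old one and sends the new ray generators to the old ones. *)
have [A PE] : exists A : 'M[int]_n, P = A *m C^T.
  have /boolp.choice[a aE] : forall j : 'I_n, exists a : 'cV_n, col j P^T = C *m a.
    move=> j; apply/CE;
      exists (col_mx (0 : 'cV[int]_1) (delta_mx j 0 : 'cV[int]_n)).
    transitivity (row_mx (\col_i y i) P^T *m
        col_mx (0 : 'cV[int]_1) (delta_mx j 0 : 'cV[int]_n)); last by [].
    by rewrite mul_row_col mulmx0 add0r colE.
  exists (\matrix_(i, j) a i j 0); apply/matrixP => i j.
  have := congr1 (fun M : 'cV_n.+1 => M j 0) (aE i); rewrite !mxE => ->.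
  by apply: eq_bigr => k _; rewrite !mxE mulrC.
set P' := C^T in kerC PE.
have freeP := fan_row_free fanP.
have A_unit : map_mx intr A \in (unitmx : pred 'M[rat]_n).
  rewrite -row_free_unit -row_leq_rank.
  apply: leq_trans (mxrankM_maxl _ (map_mx intr P')).
  by rewrite -map_mxM -PE row_leq_rank.
have A_inj (x y' : 'cV[rat]_n) : map_mx intr A *m x = map_mx intr A *m y' -> x = y'.
  by move=> /(congr1 (mulmx (invmx (map_mx intr A)))); rewrite !mulKmx.
have [primP spanP] := fanP.
have colP i : col i P = A *m col i P' by rewrite PE !colE mulmxA.
exists P'; split.
- split=> [i|x].
    apply: primitiveI => e eP'; apply: primitive_dvd (primP i) _ => j.
    rewrite colP mxE; apply: rpred_sum => k _; apply: dvdz_mull; exact: eP'.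
  have [a [a_ge0 aE]] := spanP (map_mx intr A *m x); exists a; split=> //.
  by apply: A_inj; rewrite -aE mulmxA -map_mxM -PE.
- move=> i a u u_prim u_gen [a_ge0 ai0 aE].
  have Pa : map_mx intr P *m a = map_mx intr (A *m u) :> 'cV[rat]_n.
    by rewrite PE map_mxM -mulmxA aE map_mxM.
  have intr_inj_mx (x y' : 'cV[int]_n) : map_mx intr x = map_mx intr y' :> 'cV[rat]_n -> x = y'.
    move=> /matrixP E; apply/matrixP => k l; have := E k l.
    by rewrite !mxE => /intr_inj.
  have Au_neq0 : A *m u != 0.
    apply/eqP => Au0; have u0 : u = 0.
      apply/intr_inj_mx/A_inj; rewrite -!map_mxM Au0.
      by rewrite mulmx0.
    have : (0 %| 1%R)%Z by apply: primitive_dvd u_prim _ => j; rewrite u0 mxE.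
    by rewrite dvd0z oner_eq0.
  (* As A u = k u0, the coordinates of u are k times those of u0, so its discrepancy is not smaller.
     If u0 were a ray generator v_l, then u = k v'_l and primitivity would give k = 1. *)
  have [k k_gt0 [u0 u0_prim uE]] := primitive_part Au_neq0.
  have kR_gt0 : 0 < k%:R :> rat by rewrite ltr0n.
  have cone0 : in_max_cone P i (k%:R^-1 *: a) u0.
    split=> [j||]; rewrite ?mxE ?ai0 ?mulr0 //.
      by rewrite mulr_ge0 ?invr_ge0 ?ler0n.
    rewrite -scalemxAr Pa uE map_mxZ scalerA /= -pmulrn mulVf ?scale1r //.
    by rewrite gt_eqF.
  have u0_gen l : u0 <> col l P.
    move=> u0l; have uE' : u = k%:Z *: col l P'.
      apply/intr_inj_mx/A_inj; rewrite -!map_mxM uE u0l colP.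
      by rewrite scalemxAr.
    have : (k%:Z %| 1%R)%Z.
      by apply: primitive_dvd u_prim _ => j; rewrite uE' mxE dvdz_mulr.
    rewrite dvdzE dvdn1 /= => /eqP k1; apply: (u_gen l).
    by rewrite uE' k1 scale1r.
  have sumE : \sum_j (k%:R^-1 *: a) j 0 = k%:R^-1 * \sum_j a j 0.
    by rewrite mulr_sumr; apply: eq_bigr => j _; rewrite mxE.
  have k_ge1 : 1 <= k%:R :> rat by rewrite ler1n.
  have := singP i _ u0 u0_prim u0_gen cone0; rewrite /= sumE.
  case: v {singP}; rewrite ?subr_ge0 ?subr_gt0.
    by rewrite ler_pdivlMl // mulr1; apply: le_trans.
  by rewrite ltr_pdivlMl // mulr1; apply: le_lt_trans.
split=> // [g'|i|i j ij].
- have [g <-] := pi_surj g'; have [c <-] := genQ g.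
  by exists c; rewrite sum_gmat_additive.
- by rewrite /weight ffunE pi1; apply: w_gt0.
- by rewrite /weight !ffunE !pi1; apply: w_le.
Qed.

(** * The number of torsion rows, and transport of degree matrices *)

(** Primitivity of v_k yields, by Bezout, a relation with coefficient 1 at omega_k, which eliminates
    omega_k from any combination. *)
Lemma degree_matrix_almost_free n (P : 'M[int]_(n, n.+1)) mu (Q : gmat n mu) :
  fwps_fan P -> degree_matrix_of P Q -> almost_free Q.
Proof.
move=> [primP _] [_ genQ kerQ _ _] k g.
have [c <-] := genQ g; have [x xk] := primitive_bezout (primP k).
have ck : (P^T *m x) k 0 = 1.
  by rewrite -[RHS]xk mxE; apply: eq_bigr => j _; rewrite !mxE mulrC.
have /kerQ Qx : exists x', P^T *m x = P^T *m x' by exists x.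
exists (fun i => c i - (P^T *m x) i 0 * c k).
transitivity (\sum_i Q i *~ (c i - (P^T *m x) i 0 * c k)).
  by rewrite [RHS](bigD1 k) //= ck mul1r subrr mulr0z add0r.
transitivity (\sum_i Q i *~ c i - (\sum_i Q i *~ (P^T *m x) i 0) *~ c k).
  rewrite mulrz_suml -sumrB.
  by apply: eq_bigr => i _; rewrite mulrzBr mulrzA.
by rewrite Qx mul0rz subr0.
Qed.

Section ResidueField.

Variable p : nat.
Hypothesis p_prime : prime p.

Lemma natr_mod_Fp a m : (p %| m)%N -> (a %% m)%:R = a%:R :> 'F_p.
Proof.
move=> /dvdnP[k ->]; rewrite [in RHS](divn_eq a (k * p)) natrD !natrM.
by rewrite pchar_Fp_0 ?mulr0 ?add0r.
Qed.

Lemma residues_FpD mu (g g' : Gam mu) l :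
  all (fun m => 2 <= m)%N mu -> all (dvdn p) mu ->
  (nth 0%N (residues (g + g')) l)%:R =
  (nth 0%N (residues g) l)%:R + (nth 0%N (residues g') l)%:R :> 'F_p.
Proof.
elim: mu g g' l => [|m mu IHmu] g g' [|l] //=; rewrite ?nth_nil ?addr0 //.
  move=> /andP[m_gt1 _] /andP[pm _].
  by rewrite -natrD natr_mod_Fp // Zp_cast.
by move=> /andP[_ mu_gt1] /andP[_ pmu]; apply: IHmu.
Qed.

End ResidueField.

Fixpoint Gam_delta (mu : seq nat) (l : nat) : Gam mu :=
  match mu with
  | [::] => 0
  | _ :: _ => if l is l'.+1 then (0, Gam_delta _ l') else (1, 0)
  end.

Lemma residues0 mu l : nth 0%N (residues (0 : Gam mu)) l = 0%N.
Proof. by elim: mu l => [|m mu IHmu] [|l] //=. Qed.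

Lemma residues_delta mu l k : (l < size mu)%N ->
  nth 0%N (residues (Gam_delta mu l)) k = (k == l).
Proof.
elim: mu l k => [|m mu IHmu] [|l] [|k] //=; first by rewrite residues0.
exact: IHmu.
Qed.

(* Reduction modulo a prime dividing all orders of the torsion rows turns any n
   of the columns into generators of a vector space of dimension size mu + 1. *)
Lemma almost_free_size n mu (Q : gmat n mu) : (0 < n)%N -> torsion_orders mu ->
  almost_free Q -> (size mu < n)%N.
Proof.
move=> n_gt0 [mu_gt1 mu_sorted] freeQ.
(* The last order divides all others, so any prime factor of it serves; without torsion rows every
   prime does. *)
have [p p_prime p_mu] : exists2 p, prime p & all (dvdn p) mu.
  case/lastP: mu mu_gt1 mu_sorted {Q freeQ} => [|mu m]; first by exists 2%N.
  rewrite all_rcons => /andP[m_gt1 _] mu_sorted.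
  exists (pdiv m); first exact: pdiv_prime.
  rewrite all_rcons pdiv_dvd /=; apply/allP => m' m'_mu.
  apply: dvdn_trans (pdiv_dvd m) _.
  move: mu_sorted; rewrite sorted_pairwise ?pairwise_rcons; last first.
    by move=> a b c ab ca; apply: dvdn_trans ca ab.
  by move=> /andP[/allP/(_ _ m'_mu)].
pose f (g : int * Gam mu) : 'rV['F_p]_(size mu).+1 :=
  \row_l (if l : nat is l'.+1 then (nth 0%N (residues g.2) l')%:R else g.1%:~R).
have fD : {morph f : x y / x + y}.
  move=> x y; apply/rowP => -[[|l] ?]; rewrite !mxE /= ?rmorphD //.
  exact: residues_FpD.
have f0 : f 0 = 0 by apply: (addrI (f 0)); rewrite -fD !addr0.
pose F : {additive (int * Gam mu)%type -> 'rV['F_p]_(size mu).+1} :=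
  HB.pack f (GRing.isNmodMorphism.Build _ _ f (conj f0 fD)).
have f_delta l : exists g, f g = delta_mx 0 l.
  case: l => -[|l] l_lt.
    exists (1, 0); apply/rowP => -[[|k] ?]; rewrite !mxE //=.
    by rewrite residues0.
  exists (0, Gam_delta mu l); apply/rowP => -[[|k] ?]; rewrite !mxE //=.
  by rewrite residues_delta // -val_eqE.
pose M : 'M['F_p]_(n, (size mu).+1) := \matrix_(i, l) f (Q (lift ord0 i)) 0 l.
have : row_full M.
  apply/row_fullP.
  have /boolp.choice[c cP] : forall l, exists c : 'I_n.+1 -> int,
      f (\sum_(i | i != ord0) Q i *~ c i) = delta_mx 0 l.
    move=> l; have [g <-] := f_delta l; have [c <-] := freeQ ord0 g.
    by exists c.
  exists (\matrix_(l, i) (c l (lift ord0 i))%:~R); apply/matrixP => l k.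
  have := congr1 (fun r : 'rV_ _ => r 0 k) (cP l);
    rewrite -[f _]/(F _) raddf_sum.
  rewrite big_mkcond big_ord_recl /= add0r !mxE [k == l]eq_sym => <-.
  rewrite summxE; apply: eq_bigr => i _.
  by rewrite -[f (_ *~ _)]/(F _) raddfMz -[F _]/(f _) -scaler_int !mxE.
by move=> /eqP fullM; have := rank_leq_row M; rewrite fullM.
Qed.

Lemma degree_matrix_of_aut n (P : 'M[int]_(n, n.+1)) mu (Q Q' : gmat n mu)
    (phi : {additive (int * Gam mu)%type -> (int * Gam mu)%type}) :
  bijective phi -> (forall i, Q' i = phi (Q i)) ->
  (forall i, 0 < weight Q' i) ->
  (forall i j : 'I_n.+1, (i <= j)%N -> weight Q' i <= weight Q' j) ->
  degree_matrix_of P Q -> degree_matrix_of P Q'.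
Proof.
move=> [psi phiK psiK] QE w_gt0 w_le [mu_ord genQ kerQ _ _].
have sumE (c : 'I_n.+1 -> int) :
    \sum_i Q' i *~ c i = phi (\sum_i Q i *~ c i).
  by rewrite raddf_sum; apply: eq_bigr => i _; rewrite QE raddfMz.
split=> // [g|c].
  by have [c cE] := genQ (psi g); exists c; rewrite sumE cE psiK.
rewrite (sumE (fun i => c i 0)); apply: iff_trans (kerQ c).
split=> [|->]; last exact: raddf0.
by move=> H; apply: (can_inj phiK); rewrite H raddf0.
Qed.

(** The same fan with its rays renumbered; fixing the weights keeps them sorted. *)
Lemma degree_matrix_perm n mu (Q : gmat n mu) (s : 'S_n.+1) :
  (forall i, weight Q (s i) = weight Q i) ->
  degree_matrix Q -> degree_matrix [ffun i => Q (s i)].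
Proof.
move=> ws [P [[primP spanP] [mu_ord genQ kerQ w_gt0 w_le]]].
have sumE (c : 'I_n.+1 -> int) :
    \sum_i [ffun i => Q (s i)] i *~ c i = \sum_i Q i *~ c ((s^-1)%g i).
  rewrite [RHS](reindex_inj (@perm_inj _ s)); apply: eq_bigr => i _.
  by rewrite ffunE permK.
exists (col_perm s P); do 2?split=> //.
- move=> i; rewrite (_ : col i _ = col (s i) P) //.
  by apply/matrixP => k l; rewrite !mxE.
- move=> x; have [a [a_ge0 <-]] := spanP x; exists (row_perm s a); split=> [i|].
    by rewrite mxE.
  apply/matrixP => k l; rewrite ord1 !mxE.
  by rewrite [RHS](reindex_inj (@perm_inj _ s)); apply: eq_bigr => i _;
    rewrite !mxE.
- move=> g; have [c <-] := genQ g; exists (fun i => c (s i)); rewrite sumE.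
  by apply: eq_bigr => i _; rewrite permKV.
- move=> c; rewrite (sumE (fun i => c i 0)).
  have := kerQ (row_perm s^-1 c).
  rewrite (eq_bigr (fun i => Q i *~ c ((s^-1)%g i) 0)); last by move=> i _;
    rewrite mxE.
  move=> H; apply: iff_trans H _; split=> -[x xE]; exists x.
    apply/matrixP => i j; have := congr1 (fun M : 'cV_n.+1 => M (s i) j) xE.
    rewrite !mxE permK => ->.
    by apply: eq_bigr => k _; rewrite !mxE.
  rewrite xE; apply/matrixP => i j; rewrite !mxE.
  by apply: eq_bigr => k _; rewrite !mxE permKV.
- by move=> i; rewrite /weight ffunE [X in 0 < X]ws.
- by move=> i j ij; rewrite /weight !ffunE -!/(weight _ _) !ws w_le.
Qed.

(** * Deleting torsion rows *)

Fixpoint Gam_init (mu : seq nat) (m : nat) : Gam (rcons mu m) -> Gam mu :=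
  match mu with
  | [::] => fun=> 0
  | _ :: _ => fun g => (g.1, Gam_init g.2)
  end.

Fixpoint Gam_last (mu : seq nat) (m : nat) : Gam (rcons mu m) -> 'Z_m :=
  match mu with
  | [::] => fun g => g.1
  | _ :: _ => fun g => Gam_last g.2
  end.

Lemma I1_eq0 (x : 'I_1) : x = 0.
Proof. by apply/val_inj; case: x => -[]. Qed.

Lemma Gam_rconsK mu m (g : Gam (rcons mu m)) :
  Gam_rcons (Gam_init g) (Gam_last g) = g.
Proof.
elim: mu g => [|k mu IHmu] /= [x g] /=; last by rewrite IHmu.
by rewrite [g]I1_eq0.
Qed.

Lemma Gam_init_rcons mu m (g : Gam mu) (x : 'Z_m) : Gam_init (Gam_rcons g x) = g.
Proof.
elim: mu g => [|k mu IHmu] /= g; first by rewrite [g]I1_eq0.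
by case: g => y g; rewrite IHmu.
Qed.

Lemma Gam_last_rcons mu m (g : Gam mu) (x : 'Z_m) : Gam_last (Gam_rcons g x) = x.
Proof. by elim: mu g => //= k mu IHmu [y g]; apply: IHmu. Qed.

Lemma Gam_initD mu m : {morph @Gam_init mu m : g h / g + h}.
Proof.
elim: mu => [|k mu IHmu] /= g h; first by rewrite addr0.
by rewrite IHmu.
Qed.

Lemma Gam_lastD mu m : {morph @Gam_last mu m : g h / g + h}.
Proof. by elim: mu => [|k mu IHmu] /= g h; rewrite ?IHmu. Qed.

Lemma Gam_rconsD mu m (g h : Gam mu) (x y : 'Z_m) :
  Gam_rcons (g + h) (x + y) = Gam_rcons g x + Gam_rcons h y.
Proof.
rewrite -[RHS]Gam_rconsK Gam_initD Gam_lastD.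
by rewrite !Gam_init_rcons !Gam_last_rcons.
Qed.

Lemma Gam_rcons00 mu m : Gam_rcons (0 : Gam mu) (0 : 'Z_m) = 0.
Proof.
by apply: (addrI (Gam_rcons (0 : Gam mu) (0 : 'Z_m)));
  rewrite -Gam_rconsD !addr0.
Qed.

Lemma Gam_rconsMn mu m (g : Gam mu) (x : 'Z_m) (k : nat) :
  Gam_rcons g x *+ k = Gam_rcons (g *+ k) (x *+ k).
Proof.
elim: k => [|k IHk]; first by rewrite !mulr0n Gam_rcons00.
by rewrite !mulrS IHk Gam_rconsD.
Qed.

Lemma morphD_morph0 (U V : zmodType) (f : U -> V) :
  {morph f : x y / x + y} -> f 0 = 0.
Proof. by move=> fD; apply: (addrI (f 0)); rewrite -fD !addr0. Qed.

Lemma additive_of_morphD (U V : zmodType) (f : U -> V) :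
  {morph f : x y / x + y} -> {F : {additive U -> V} | F =1 f}.
Proof.
move=> fD; have f0 := morphD_morph0 fD.
pose F : {additive U -> V} :=
  HB.pack f (GRing.isNmodMorphism.Build _ _ f (conj f0 fD)).
by exists F.
Qed.

Lemma torsion_orders_subseq mu mu' : subseq mu' mu ->
  torsion_orders mu -> torsion_orders mu'.
Proof.
move=> sub [mu_gt1 mu_sorted]; split.
  by apply/allP => m /(mem_subseq sub); apply: (allP mu_gt1).
apply: subseq_sorted sub mu_sorted => a b c ab ca; exact: dvdn_trans ca ab.
Qed.

Lemma adjoinK n mu m (R : gmat n (rcons mu m)) :
  adjoin [ffun i => ((R i).1, Gam_init (R i).2)] [ffun i => Gam_last (R i).2] = R.
Proof.
by apply/ffunP => i; rewrite !ffunE /= Gam_rconsK -surjective_pairing.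
Qed.

Lemma weight_adjoin n mu (Q : gmat n mu) m (eta : {ffun 'I_n.+1 -> 'Z_m}) i :
  weight (adjoin Q eta) i = weight Q i.
Proof. by rewrite /weight ffunE. Qed.

Lemma Zp_natmul m (x : 'Z_m) : x = 1 *+ x.
Proof. by rewrite [RHS]natr_Zp. Qed.

(** The kernel of the projection is the last cyclic factor, generated by its unit. *)
Lemma degree_matrix_at_most_init v n mu m (Q : gmat n mu)
    (eta : {ffun 'I_n.+1 -> 'Z_m}) : (0 < n)%N ->
  degree_matrix_at_most v (adjoin Q eta) -> degree_matrix_at_most v Q.
Proof.
move=> n_gt0 degR; have [P [_ _ [muR_ord _ _ _ _]]] := degR.
pose f (g : int * Gam (rcons mu m)) := (g.1, Gam_init g.2).
have fD : {morph f : x y / x + y} by move=> x y; rewrite /f /= Gam_initD.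
have [pi piE] := additive_of_morphD fD.
have -> : Q = [ffun i => pi (adjoin Q eta i)].
  apply/ffunP => i; rewrite !ffunE piE /f /= Gam_init_rcons.
  exact: surjective_pairing.
apply: (degree_matrix_at_most_quotient (g0 := (0, Gam_rcons 0 1))) degR => //.
- by apply: torsion_orders_subseq muR_ord; rewrite subseq_rcons.
- by move=> g; rewrite piE.
- move=> g; exists (g.1, Gam_rcons g.2 0).
  by rewrite piE /f Gam_init_rcons -surjective_pairing.
- by rewrite piE /f Gam_init_rcons.
move=> g; rewrite piE => -[g1 g2]; exists (Gam_last g.2 : nat)%:Z.
rewrite -pmulrn; apply: injective_projections.
  by rewrite (raddfMn fst) /= mul0rn.
rewrite (raddfMn snd) /= Gam_rconsMn mul0rn -Zp_natmul -g2.
by rewrite Gam_rconsK.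
Qed.

(** As before, with the last but one cyclic factor as kernel. *)
Lemma degree_matrix_at_most_skip v n mu m m' (Q : gmat n mu)
    (eta : {ffun 'I_n.+1 -> 'Z_m}) (eta' : {ffun 'I_n.+1 -> 'Z_m'}) : (0 < n)%N ->
  degree_matrix_at_most v (adjoin (adjoin Q eta) eta') ->
  degree_matrix_at_most v (adjoin Q eta').
Proof.
move=> n_gt0 degR; have [P [_ _ [muR_ord _ _ _ _]]] := degR.
pose f (g : int * Gam (rcons (rcons mu m) m')) :=
  (g.1, Gam_rcons (Gam_init (Gam_init g.2)) (Gam_last g.2)).
have fD : {morph f : x y / x + y}.
  by move=> x y; rewrite /f /= !Gam_initD Gam_lastD Gam_rconsD.
have [pi piE] := additive_of_morphD fD.
have -> : adjoin Q eta' = [ffun i => pi (adjoin (adjoin Q eta) eta' i)].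
  by apply/ffunP => i; rewrite !ffunE piE /f /= !Gam_init_rcons Gam_last_rcons.
apply: (degree_matrix_at_most_quotient
  (g0 := (0, Gam_rcons (Gam_rcons 0 1) 0))) degR => //.
- apply: torsion_orders_subseq muR_ord.
  by rewrite -!cats1 cat_subseq // prefix_subseq // prefix_prefix.
- by move=> g; rewrite piE.
- move=> g; exists (g.1, Gam_rcons (Gam_rcons (Gam_init g.2) 0) (Gam_last g.2)).
  by rewrite piE /f !Gam_init_rcons Gam_last_rcons Gam_rconsK -surjective_pairing.
- by rewrite piE /f !Gam_init_rcons Gam_last_rcons Gam_rcons00.
move=> g; rewrite piE => -[g1 g2]; exists (Gam_last (Gam_init g.2) : nat)%:Z.
have g2i := congr1 (@Gam_init _ _) g2; have g2l := congr1 (@Gam_last _ _) g2.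
move: g2i g2l; rewrite -[0 in X in X -> _]Gam_rcons00 -[0 in X in _ -> X -> _]Gam_rcons00.
rewrite !Gam_init_rcons !Gam_last_rcons => g2i g2l.
rewrite -pmulrn; apply: injective_projections.
  by rewrite (raddfMn fst) /= mul0rn.
rewrite (raddfMn snd) /= !Gam_rconsMn !mul0rn -Zp_natmul -g2i -g2l.
by rewrite !Gam_rconsK.
Qed.

(** * Minimality of matrices with a row deleted *)

Lemma size_residues mu (g : Gam mu) : size (residues g) = size mu.
Proof. by elim: mu g => //= m mu IHmu g; rewrite IHmu. Qed.

Lemma residues_rcons mu m (g : Gam mu) (x : 'Z_m) :
  residues (Gam_rcons g x) = rcons (residues g) x.
Proof. by elim: mu g => //= k mu IHmu g; rewrite IHmu. Qed.

Definition torsion_row n m (eta : {ffun 'I_n.+1 -> 'Z_m}) : seq int :=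
  [seq (nat_of_ord (eta i))%:Z | i <- enum 'I_n.+1].

Lemma row_word_adjoin n mu (Q : gmat n mu) m (eta : {ffun 'I_n.+1 -> 'Z_m}) :
  row_word (adjoin Q eta) = row_word Q ++ torsion_row eta :> seq int.
Proof.
rewrite /row_word size_rcons -[X in iota 0 X]addn1 iotaD map_cat flatten_cat add0n.
have adjE i l : nth 0 (((adjoin Q eta) i).1 ::
      [seq k%:Z | k <- residues ((adjoin Q eta) i).2]) l =
    nth 0 (rcons ((Q i).1 :: [seq k%:Z | k <- residues (Q i).2])
      (nat_of_ord (eta i))%:Z) l.
  by rewrite ffunE /= residues_rcons map_rcons.
congr (_ ++ _).
  congr flatten; apply/eq_in_map => l; rewrite mem_iota /= => l_lt.
  apply: eq_map => i; rewrite adjE nth_rcons /= size_map size_residues.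
  by rewrite l_lt.
rewrite /= cats0; apply: eq_map => i; rewrite ffunE /= residues_rcons map_rcons.
by rewrite nth_rcons size_map size_residues ltnn eqxx.
Qed.

Lemma size_row_word n mu (Q : gmat n mu) :
  size (row_word Q) = ((size mu).+1 * n.+1)%N.
Proof. by rewrite size_allpairs size_iota size_enum_ord. Qed.

Lemma lexi_cat (disp : Order.disp_t) (T : orderType disp) (s s' t t' : seqlexi T) :
  size s = size s' ->
  ((s ++ t : seqlexi T) <= (s' ++ t' : seqlexi T))%O =
  (s <= s')%O && ((s' <= s)%O ==> (t <= t')%O).
Proof.
elim: s s' => [|x s IHs] [|y s'] //= [sz].
rewrite !lexi_cons IHs //.
by case: (ltgtP x y) => //= _; rewrite ?andbT ?andbF //=.
Qed.

Lemma lexi_map_Posz (s t : seqlexi nat) :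
  (([seq k%:Z | k <- s] : seqlexi int) <= ([seq k%:Z | k <- t] : seqlexi int))%O
  = (s <= t)%O.
Proof.
elim: s t => [|x s IHs] [|y t] //=.
by rewrite !lexi_cons IHs !lez_nat.
Qed.

Lemma degree_matrix_aut n mu (R R' : gmat n mu) mu' (Q' : gmat n mu')
    (phi : {additive (int * Gam mu)%type -> (int * Gam mu)%type}) :
  bijective phi -> (forall i, R' i = phi (R i)) ->
  (forall i, weight R' i = weight Q' i) -> degree_matrix Q' ->
  degree_matrix R -> degree_matrix R'.
Proof.
move=> phi_bij RE ww [P' [_ [_ _ _ w_gt0 w_le]]] [P [fanP degR]].
exists P; split=> //; apply: (degree_matrix_of_aut phi_bij RE _ _ degR).
  by move=> i; rewrite ww; apply: w_gt0.
by move=> i j ij; rewrite !ww; apply: w_le.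
Qed.

Lemma minimal_row_minimal n mu (Q : gmat n mu) :
  degree_matrix Q -> minimal Q -> row_minimal Q.
Proof.
move=> degQ minQ Q' QQ'; apply: minQ; exists 1%g.
have -> : [ffun i => Q ((1%g : 'S_n.+1) i)] = Q.
  by apply/ffunP => i; rewrite ffunE perm1.
by split=> // i; rewrite perm1.
Qed.

Lemma minimal_init n mu m (Q : gmat n mu) (eta : {ffun 'I_n.+1 -> 'Z_m}) :
  degree_matrix (adjoin Q eta) -> minimal (adjoin Q eta) -> minimal Q.
Proof.
move=> degR minR Q' [s [degQ ws [degQs degQ' [phi [[psi phiK psiK] Q'E]]]]].
(* [lift f] applies f to all rows but the last, which it keeps; only the column permutation moves
   that row. *)
pose lift (f : int * Gam mu -> int * Gam mu) (g : int * Gam (rcons mu m)) :=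
  let h := f (g.1, Gam_init g.2) in (h.1, Gam_rcons h.2 (Gam_last g.2)).
have liftK f f' : cancel f f' -> cancel (lift f) (lift f').
  move=> fK g; rewrite /lift /= Gam_init_rcons Gam_last_rcons.
  by rewrite -surjective_pairing fK Gam_rconsK -surjective_pairing.
have liftD : {morph lift phi : x y / x + y}.
  move=> x y; rewrite /lift /= Gam_initD Gam_lastD.
  rewrite (_ : (_, _) = (x.1, Gam_init x.2) + (y.1, Gam_init y.2)) //.
  by rewrite raddfD /= Gam_rconsD.
have [Phi PhiE] := additive_of_morphD liftD.
have Phi_bij : bijective Phi.
  by exists (lift psi) => g; rewrite PhiE; apply: liftK.
pose eta' := [ffun i => eta (s i)].
have RE i : adjoin Q' eta' i = Phi ([ffun i => adjoin Q eta (s i)] i).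
  rewrite PhiE /lift !ffunE /= Gam_init_rcons Gam_last_rcons Q'E ffunE.
  by rewrite -surjective_pairing.
have wsR i : weight (adjoin Q eta) (s i) = weight (adjoin Q eta) i.
  by rewrite !weight_adjoin.
have degRs := degree_matrix_perm wsR degR.
have degR' : degree_matrix (adjoin Q' eta').
  by apply: degree_matrix_aut Phi_bij RE _ degQ' degRs => i;
    rewrite weight_adjoin.
have /minR : Defs.equiv (adjoin Q eta) (adjoin Q' eta').
  by exists s; split=> //; split=> //; exists Phi.
rewrite !row_word_adjoin lexi_cat ?size_row_word //.
by case/andP.
Qed.

Lemma row_minimal_skip n mu m m' (Q : gmat n mu)
    (eta : {ffun 'I_n.+1 -> 'Z_m}) (eta' : {ffun 'I_n.+1 -> 'Z_m'}) :
  degree_matrix (adjoin (adjoin Q eta) eta') ->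
  row_minimal (adjoin (adjoin Q eta) eta') -> row_minimal (adjoin Q eta').
Proof.
move=> degR minR Q' [degQ degQ' [phi [[psi phiK psiK] Q'E]]].
(* [lift f] keeps the last but one row and applies f to the others. *)
pose lift (f : int * Gam (rcons mu m') -> int * Gam (rcons mu m'))
    (g : int * Gam (rcons (rcons mu m) m')) :=
  let h := f (g.1, Gam_rcons (Gam_init (Gam_init g.2)) (Gam_last g.2)) in
  (h.1, Gam_rcons (Gam_rcons (Gam_init h.2) (Gam_last (Gam_init g.2)))
          (Gam_last h.2)).
have liftK f f' : cancel f f' -> cancel (lift f) (lift f').
  move=> fK g; rewrite /lift /= !Gam_init_rcons !Gam_last_rcons Gam_rconsK.
  rewrite -surjective_pairing fK /= Gam_init_rcons Gam_last_rcons.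
  by rewrite !Gam_rconsK -surjective_pairing.
have liftD : {morph lift phi : x y / x + y}.
  move=> x y; rewrite /lift /= !Gam_initD !Gam_lastD Gam_rconsD.
  set X := Gam_rcons (Gam_init (Gam_init x.2)) _.
  set Y := Gam_rcons (Gam_init (Gam_init y.2)) _.
  rewrite (_ : (_, X + Y) = (x.1, X) + (y.1, Y)) //.
  by rewrite raddfD /= Gam_initD Gam_lastD !Gam_rconsD.
have [Phi PhiE] := additive_of_morphD liftD.
have Phi_bij : bijective Phi.
  by exists (lift psi) => g; rewrite PhiE; apply: liftK.
move: Q'E degQ'; rewrite -(adjoinK Q').
set Q1 := [ffun i => _] : gmat n mu; set eta1 := [ffun i => Gam_last _].
move=> Q'E degQ'.
pose R' := adjoin (adjoin Q1 eta) eta1.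
have RE i : R' i = Phi (adjoin (adjoin Q eta) eta' i).
  rewrite PhiE /lift !ffunE /= !Gam_init_rcons !Gam_last_rcons.
  by have := Q'E i; rewrite !ffunE /= => <-;
    rewrite /= Gam_init_rcons Gam_last_rcons.
have degR' : degree_matrix R'.
  by apply: degree_matrix_aut Phi_bij RE _ degQ' degR => i;
    rewrite !weight_adjoin.
have /minR : row_equiv (adjoin (adjoin Q eta) eta') R' by split=> //;
  exists Phi.
rewrite !row_word_adjoin.
have := size_row_word Q; have := size_row_word Q1.
move: (row_word Q) (row_word Q1) => W W1 szW1 szW.
(* The kept row is the same block at the same place in both words, so it does not affect the
   comparison. *)
by rewrite -!catA !lexi_cat ?szW ?szW1 ?size_map // lexx.
Qed.

(** Bridges the two notions of row-minimality: [Gam [:: m]] has an extra trivial factor ['I_1], and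
    equal weight rows reduce the comparison to the torsion rows. *)
Lemma row_minimal_torsion n m (w : gmat n [::]) (eta : {ffun 'I_n.+1 -> 'Z_m}) :
  degree_matrix (adjoin w eta) -> row_minimal (adjoin w eta) ->
  torsion_row_minimal w eta.
Proof.
move=> degR minR eta' degR' [phi [[psi phiK psiK] phiE]].
pose lift (f : int * 'Z_m -> int * 'Z_m) (g : int * Gam (rcons [::] m)) :
    int * Gam (rcons [::] m) :=
  let h := f (g.1, g.2.1) in (h.1, (h.2, 0)).
have liftK f f' : cancel f f' -> cancel (lift f) (lift f').
  move=> fK [z [x o]]; rewrite /lift /= -surjective_pairing fK /=.
  by rewrite [o]I1_eq0.
have liftD : {morph lift phi : x y / x + y}.
  move=> x y; rewrite /lift /=.
  rewrite (_ : (_, _) = (x.1, x.2.1) + (y.1, y.2.1)) // raddfD /=.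
  by congr (_, _); congr (_, _); rewrite addr0.
have [Phi PhiE] := additive_of_morphD liftD.
have Phi_bij : bijective Phi.
  by exists (lift psi) => g; rewrite PhiE; apply: liftK.
have /minR : row_equiv (adjoin w eta) (adjoin w eta').
  split=> //; exists Phi; split=> // i.
  by rewrite PhiE /lift !ffunE /=; have := phiE i; rewrite /weight => ->.
rewrite !row_word_adjoin lexi_cat // lexx /= /torsion_row.
by rewrite (map_comp Posz) (map_comp Posz (fun i => nat_of_ord (eta' i))) lexi_map_Posz.
Qed.

(** * The procedure *)

Local Open Scope classical_set_scope.

Lemma at_most_degree_matrix v n mu (Q : gmat n mu) :
  degree_matrix_at_most v Q -> degree_matrix Q.
Proof. by case=> P [fanP _ degQ]; exists P. Qed.

(** The automorphisms of Z are 1 and -1, positivity excludes -1, and the permutations fix w: it is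
    equivalent only to itself. *)
Lemma weight_vector_minimal n (w : gmat n [::]) : minimal w.
Proof.
move=> Q' [s [[P [_ degw]] ws [_ [P' [_ degQ']] [phi [[psi phiK psiK] Q'E]]]]].
have [_ _ _ w_gt0 _] := degw; have [_ _ _ w'_gt0 _] := degQ'.
pose e := (phi (1, 0)).1.
have phiE (g : int * 'I_1) : phi g = (e * g.1, 0).
  case: g => k o; rewrite (_ : (k, o) = (1, 0) *~ k); last first.
    apply: injective_projections; last by rewrite [RHS]I1_eq0 [LHS]I1_eq0.
    by rewrite (raddfMz fst) /= intz.
  rewrite raddfMz; apply: injective_projections; last exact: I1_eq0.
  by rewrite (raddfMz fst) /= mulrzz (raddfMz fst) /= intz.
have w_s i : (w (s i)).1 = (w i).1 by apply: ws.
have e_gt0 : 0 < e.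
  have := w'_gt0 ord0; rewrite /weight Q'E phiE ffunE /= w_s.
  by rewrite pmulr_lgt0 //; apply: w_gt0.
have e1 : e = 1.
  have := psiK (1, 0); rewrite phiE => -[/(congr1 absz)/eqP].
  by rewrite abszM muln_eq1 => /andP[/eqP e1 _]; rewrite -(gtz0_abs e_gt0) e1.
rewrite (_ : Q' = w) //; apply/ffunP => i.
rewrite Q'E ffunE phiE e1 mul1r w_s.
by apply: injective_projections => //=; rewrite [RHS]I1_eq0.
Qed.

Lemma calM_at_most v n i (Q : tmat n) (t : tvec n) :
  calM v n i Q t -> degree_matrix_at_most v (tagged (tadjoin Q t)).
Proof.
case: i => [[w [-> _ wt _]]|i]; first exact: wt.
by case=> Q0 [t0 [_ _ _ _ []]].
Qed.

Lemma calQ_sound v n i (Q : tmat n) : calQ v n i Q ->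
  [/\ degree_matrix_at_most v (tagged Q), minimal (tagged Q) & size (tag Q) = i].
Proof.
elim: i Q => [|i IHi] Q.
  by case=> w [degw ->]; split=> //; apply: weight_vector_minimal.
case=> Q0 [t [/IHi[_ _ <-] Mt -> minQ]]; split=> //;
  first exact: calM_at_most Mt.
by rewrite size_rcons.
Qed.

(** The second claim carries the induction: the last row of a minimal matrix must belong to the set
    M of its predecessor. *)
Lemma calQ_complete v n i (Q : tmat n) : (0 < n)%N -> size (tag Q) = i ->
  degree_matrix_at_most v (tagged Q) -> minimal (tagged Q) ->
  calQ v n i Q /\
  forall t : tvec n, degree_matrix_at_most v (tagged (tadjoin Q t)) ->
    row_minimal (tagged (tadjoin Q t)) -> calM v n i Q t.
Proof.
move=> n_gt0; elim: i Q => [|i IHi] [mu Q].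
  rewrite /=; case: mu Q => //= w _ degw minw; split; first by exists w.
  move=> [m eta] /= degR minR; exists w; split=> //.
    by case: degR => P [_ _ [[/= /andP[]]]].
  exact: row_minimal_torsion (at_most_degree_matrix degR) minR.
rewrite /=; case/lastP: mu Q => // mu m Q; rewrite size_rcons => -[sz].
rewrite -(adjoinK Q); set Q0 := [ffun i => _] : gmat n mu.
set eta := [ffun i => Gam_last _] => degR minR.
have degQ0 := degree_matrix_at_most_init n_gt0 degR.
have degR' := at_most_degree_matrix degR.
have minQ0 := minimal_init degR' minR.
pose T0 : tmat n := Tagged (gmat n) Q0.
pose t : tvec n := Tagged (fun m : nat => {ffun 'I_n.+1 -> 'Z_m}) eta.
have [QQ0 MQ0] := IHi T0 sz degQ0 minQ0.
have Mt : calM v n i T0 t by apply: MQ0 => //; apply: minimal_row_minimal.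
split; first by exists T0, t.
(* A row in M(Q_eta) must already be in M(Q), which is seen by deleting eta from between them. *)
move=> [m' eta'] degR1 minR1; exists T0, t; split=> //.
  apply: MQ0; first exact: degree_matrix_at_most_skip n_gt0 degR1.
  exact: row_minimal_skip (at_most_degree_matrix degR1) minR1.
have [P [fanP _ degP]] := degR1.
split=> //.
- have [[_ mu_sorted] _ _ _ _] := degP; move: mu_sorted.
  rewrite /= -!cats1 -catA /= sorted_pairwise; last first.
    by move=> a b c ab ca; apply: dvdn_trans ca ab.
  by rewrite pairwise_cat /= => /and3P[_ _ /andP[/andP[]]].
- exact: order_bound_at_most n_gt0 degR1.
- exact: degree_matrix_almost_free fanP degP.
Qed.

Lemma initial_Q_finite v n : (0 < n)%N -> finite_set (initial_Q v n).
Proof.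
move=> n_gt0; pose B := (weight_ratio n n ^ n)%N.
pose g (f : {ffun 'I_n.+1 -> 'I_B.+1}) : tmat n :=
  Tagged (gmat n) ([ffun i => ((f i : nat)%:Z, 0)] : gmat n [::]).
apply: (@sub_finite_set _ _ (g @` [set: {ffun 'I_n.+1 -> 'I_B.+1}]));
  last first.
  exact/finite_image/finite_finset.
move=> _ [w [[P [_ singP degP]] ->]].
exists [ffun i => inord (natwt w i)] => //; rewrite /g; congr (Tagged _ _).
apply/ffunP => i; rewrite !ffunE inordK.
  by rewrite (natwtE degP); apply: injective_projections => //=;
    rewrite [RHS]I1_eq0.
rewrite ltnS; apply: leq_trans (leq_natwtsum w i) _.
exact: fan_natwtsum_le n_gt0 singP degP erefl.
Qed.

Lemma initial_M_finite v n (Q : tmat n) : (0 < n)%N ->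
  finite_set (initial_M v n Q).
Proof.
move=> n_gt0.
have [[w ->]|noQ] := pselect (exists w : gmat n [::], Q = Tagged (gmat n) w);
  last first.
  rewrite (_ : initial_M v n Q = set0); first exact: finite_set0.
  by apply/seteqP; split=> // t [w [QE _ _ _]]; apply: noQ; exists w.
(* For a single torsion row the order bound m \prod_i w_i <= h^(n-1) gives m <= h^(n-1). *)
pose B := (natwtsum w ^ n.-1)%N.
pose U : finType := {m : 'I_B.+1 & {ffun 'I_n.+1 -> 'Z_m}}.
pose g (u : U) : tvec n :=
  Tagged (fun m : nat => {ffun 'I_n.+1 -> 'Z_m}) (tagged u).
apply: (@sub_finite_set _ _ (g @` [set: U])); last first.
  exact/finite_image/finite_finset.
move=> [m eta] [w' [ww' _ deg _]].
have {}ww' : w = w' by exact: (eq_from_Tagged ww').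
rewrite -ww' /= in deg; have [P [_ singP degP]] := deg.
have m_le : (m < B.+1)%N.
  have := fan_order_bound n_gt0 singP degP; rewrite /= big_seq1 ltnS.
  have -> : natwtsum (adjoin w eta) = natwtsum w.
    by apply: eq_bigr => i _; rewrite /natwt weight_adjoin.
  apply: leq_trans; rewrite leq_pmulr //; apply: prodn_gt0 => i.
  exact: natwt_gt0 degP _.
by exists (Tagged (fun m : 'I_B.+1 => {ffun 'I_n.+1 -> 'Z_m}) (i := Ordinal m_le) eta).
Qed.

Lemma stage_finite v n i : (0 < n)%N ->
  finite_set (calQ v n i) /\
  forall Q, calQ v n i Q -> finite_set (calM v n i Q).
Proof.
move=> n_gt0; elim: i => [|i [finQ finM]].
  by split=> [|Q _]; [apply: initial_Q_finite | apply: initial_M_finite].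
split=> [|Q _].
  apply: (@sub_finite_set _ _ (\bigcup_(Q in calQ v n i) (tadjoin Q @` calM v n i Q))).
    by move=> _ [Q [t [QQ Mt -> _]]]; exists Q => //; exists t.
  by apply: bigcup_finite => // Q /finM; apply: finite_image.
apply: (@sub_finite_set _ _ (\bigcup_(Q in calQ v n i) calM v n i Q)).
  by move=> t [Q0 [t0 [QQ0 _ _ Mt _]]]; exists Q0.
exact: bigcup_finite.
Qed.

Lemma degree_matrix_at_most_size v n mu (Q : gmat n mu) : (0 < n)%N ->
  degree_matrix_at_most v Q -> (size mu < n)%N.
Proof.
move=> n_gt0 [P [fanP _ degP]].
apply: almost_free_size n_gt0 _ (degree_matrix_almost_free fanP degP).
by case: degP.
Qed.

Theorem mainTheorem5 (v : version) (n : nat) (n_gt0 : (1 <= n)%N) :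
  exists N : nat,
    [/\ stops_at v n N,
        forall i, (i <= N)%N ->
          finite_set (calQ v n i) /\
          forall Q, calQ v n i Q -> finite_set (calM v n i Q)
      & \bigcup_(i in [set i | (i <= N)%N]) calQ v n i =
        [set Q : tmat n | degree_matrix_at_most v (tagged Q) /\
                          minimal (tagged Q)]].
Proof.
(* No degree matrix has n torsion rows, so the criterion holds vacuously at stage n. For n = 1 this
   is what stops the recursion, as the index n - 1 = 0 is not visited. *)
have stop_n : stop v n n.
  left=> Q /calQ_sound[degQ _ szQ].
  by have := degree_matrix_at_most_size n_gt0 degQ; rewrite szQ ltnn.
have ex_stop : exists i, `[< (1 <= i)%N /\ stop v n i >].
  by exists n; apply/asboolP.
case: (ex_minnP ex_stop) => N /asboolP[N_gt0 stopN] N_min; exists N; split.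
- split=> // i /andP[i_gt0 iN] stop_i.
  have : (N <= i)%N by apply: N_min; apply/asboolP.
  by rewrite leqNgt iN.
- by move=> i _; apply: stage_finite.
apply/seteqP; split=> [Q [i _ /calQ_sound[]] //|Q [degQ minQ]].
have [QQ _] := calQ_complete n_gt0 erefl degQ minQ.
(* More than N torsion rows are impossible: N = n - 1 is the maximal number, and otherwise empty
   sets M at stage N make all later stages empty. *)
exists (size (tag Q)) => //=; rewrite leqNgt; apply/negP => N_lt.
case: stopN => [M_empty|NE]; last first.
  have := degree_matrix_at_most_size n_gt0 degQ.
  by move: N_lt; rewrite NE; lia.
have Q_empty j : calQ v n (j + N.+1) = set0.
  elim: j => [|j IHj]; apply/seteqP; split=> // R [Q0 [t [QQ0 Mt _ _]]].
    by have /seteqP[/(_ t Mt)] := M_empty Q0 QQ0.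
  by have /seteqP[/(_ Q0 QQ0)] := IHj.
by have /seteqP[+ _] := Q_empty (size (tag Q) - N.+1)%N;
  rewrite subnK // => /(_ Q QQ).
Qed.
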